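(* Let $X=(X(t))_{t\in\mathbb{R}}$ be the positive supOU process with characteristics $\pi$ and $\lambda$ (as defined in the context). Assume that $\int_{(0,1]} z\,\lambda(\mathrm{d}z)<\infty$ and $m_0(\pi)=\pi((0,\infty))<\infty$. Let $f:[1,\infty)\to\mathbb{R}$ be a nondecreasing function with $f(1)>0$ and $\lim_{t\to\infty}f(t)=\infty$. (i) If for some $K>0$ $$\int_1^\infty \overline{\lambda}(K f(t))\,\mathrm{d}t=\infty,$$ then $$\limsup_{t\to\infty}\frac{X(t)}{f(t)}\ge K\quad\text{almost surely.}$$ (ii) Conversely, assume in addition that $f$ is strictly increasing and differentiable, and that its inverse $f^{\leftarrow}$ is submultiplicative. If for some $L>0$ $$\int_1^\infty\left(\overline{\lambda}(L f(t))+\overline{\eta}(L f(t))\right)\mathrm{d}t<\infty,$$ then $$\limsup_{t\to\infty}\frac{X(t)}{f(t)}\le 2L\quad\text{almost surely.}$$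
   Context: For a measure $Q$ on $(0,\infty)$ write $m_p(Q)=\int_{(0,\infty)}x^p\,Q(\mathrm{d}x)$ and $\overline{Q}(x)=Q((x,\infty))$ for $x>0$. Setting: $\pi$ is a nonzero measure on $(0,\infty)$ with $m_{-1}(\pi)=\int_{(0,\infty)}x^{-1}\pi(\mathrm{d}x)<\infty$. $\lambda$ is a Lévy measure on $(0,\infty)$, i.e. $\int_{(0,\infty)}(1\wedge z^2)\lambda(\mathrm{d}z)<\infty$, satisfying $\int_{(1,\infty)}\log z\,\lambda(\mathrm{d}z)<\infty$. $\mu$ is a Poisson random measure on $(0,\infty)\times\mathbb{R}\times(0,\infty)$ with intensity measure $\nu(\mathrm{d}x,\mathrm{d}s,\mathrm{d}z)=\pi(\mathrm{d}x)\,\mathrm{d}s\,\lambda(\mathrm{d}z)$, with points $(\xi_k,\tau_k,\zeta_k)_{k\ge 0}$. When $\int_{(0,1]}z\,\lambda(\mathrm{d}z)<\infty$, the positive supOU process (drift chosen so that there is no centering) is $$X(t)=\sum_{k:\tau_k\le t}e^{-\xi_k(t-\tau_k)}\zeta_k,\qquad t\in\mathbb{R}.$$ The Lévy measure $\eta$ of the stationary marginal law of $X$ is $$\eta(B)=m_{-1}(\pi)\,(\mathrm{Leb}\times\lambda)\big(\{(u,z):u>0,\ z>0,\ e^{-u}z\in B\}\big),$$ for Borel $B\subset(0,\infty)$; in particular $\overline{\eta}(r)=m_{-1}(\pi)\int_r^\infty \overline{\lambda}(z)z^{-1}\,\mathrm{d}z$. A function $g$ is submultiplicative if there exists $a>0$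 such that $g(x+y)\le a\,g(x)g(y)$ for all $x,y$ (for $f^{\leftarrow}$: for all $x,y$ in its domain $[f(1),\infty)$). *)

(* Defs.v *)
From HB Require Import structures.
From mathcomp Require Export all_boot all_order all_algebra.
From mathcomp Require Export all_classical all_reals all_analysis.
From mathcomp Require Export measurable_realfun.
Export Order.TTheory GRing.Theory Num.Theory.
Export numFieldNormedType.Exports.

Set Implicit Arguments.
Unset Strict Implicit.
Unset Printing Implicit Defensive.


Local Open Scope classical_set_scope.
Local Open Scope ring_scope.

(* A measure on (0, oo) is a Borel measure Q on R carrying no mass outside
   (0, oo); so is the Poisson random measure on (0, oo) x R x (0, oo), which is
   a random measure on R * R * R. *)
Definition on_positive_half_line (R : realType)
    (Q : set (measurableTypeR R) -> \bar R) : Prop :=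
  Q (~` `]0, +oo[) = 0%E.

Definition moment (R : realType) (p : R)
    (Q : set (measurableTypeR R) -> \bar R) : \bar R :=
  (\int[Q]_(x in `]0%R, +oo[) (x `^ p)%:E)%E.

Definition tail (R : realType) (Q : set (measurableTypeR R) -> \bar R)
    (x : R) : \bar R :=
  Q `]x, +oo[%classic.

Definition levy_measure (R : realType)
    (lam : set (measurableTypeR R) -> \bar R) : Prop :=
  on_positive_half_line lam /\
  (\int[lam]_(z in `]0%R, +oo[) (Num.min 1 (z ^+ 2))%:E < +oo)%E.

(* N has the Poisson law of mean c. The law of mean +oo is the point mass at
   +oo. The second argument of [poisson_prob] is a dummy, and
   [poisson_prob 0 _] is the point mass at 0. *)
Definition poisson_distributed d (Omega : measurableType d) (R : realType)
    (P : probability Omega R) (N : Omega -> \bar R) (c : \bar R) : Prop :=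
  match c with
  | r%:E => forall U : set nat,
      P [set w | exists2 k, U k & N w = k%:R%:E] = poisson_prob r 0 U
  | +oo%E => P [set w | N w = +oo%E] = 1%E
  | -oo%E => False
  end.

(* Taking some of the S i equal to setT gives the product rule for every
   subfamily. *)
Definition mutually_independent d (Omega : measurableType d) (R : realType)
    (P : probability Omega R) n (N : 'I_n -> Omega -> \bar R) : Prop :=
  forall S : 'I_n -> set (\bar R), (forall i, measurable (S i)) ->
    P (\bigcap_(i in [set: 'I_n]) (N i @^-1` S i)) =
    (\prod_(i < n) P (N i @^-1` S i))%E.

Definition poisson_random_measure d d' (Omega : measurableType d)
    (E : measurableType d') (R : realType) (P : probability Omega R)
    (nu : set E -> \bar R) (mu : Omega -> {measure set E -> \bar R}) : Prop :=
  [/\ forall B, measurable B -> measurable_fun setT (fun w => mu w B),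
      forall B, measurable B -> poisson_distributed P (fun w => mu w B) (nu B)
    & forall n (B : 'I_n -> set E), (forall i, measurable (B i)) ->
        trivIset setT B ->
        mutually_independent P (fun i w => mu w (B i))].

(* pi(dx) ds lambda(dz) *)
Definition supou_intensity (R : realType)
    (pim lam : {measure set (measurableTypeR R) -> \bar R}) :
    set (measurableTypeR R * measurableTypeR R * measurableTypeR R) -> \bar R :=
  (pim \x lebesgue_measure \x lam)%E.

(* The points of mu are (xi k, tau k, zeta k), counted with multiplicity. The
   k-th one is present on the event A k only, so that the number of points may
   be finite (it is zero when lambda = 0); off A k the values of xi k, tau k and
   zeta k are irrelevant. *)
Definition supou_points d (Omega : measurableType d) (R : realType)
    (P : probability Omega R)
    (mu : Omega -> {measure set (measurableTypeR R * measurableTypeR R *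
                                 measurableTypeR R) -> \bar R})
    (A : nat -> set Omega)
    (xi tau zeta : nat -> {RV P >-> measurableTypeR R}) : Prop :=
  [/\ forall k, measurable (A k),
      forall k w, A k w -> 0 < xi k w /\ 0 < zeta k w
    & forall w B, measurable B ->
        mu w B =
        (\esum_(k in [set k | A k w]) \d_((xi k w, tau k w, zeta k w)) B)%E].

(* The sum of nonnegative terms defining the process, in [0, +oo]. *)
Definition supou d (Omega : measurableType d) (R : realType)
    (P : probability Omega R) (A : nat -> set Omega)
    (xi tau zeta : nat -> {RV P >-> measurableTypeR R})
    (t : R) (w : Omega) : \bar R :=
  (\esum_(k in [set k | A k w /\ (tau k w <= t)%R])
     (expR (- xi k w * (t - tau k w)) * zeta k w)%:E)%E.

Definition supou_marginal_levy_measure (R : realType)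
    (pim lam : set (measurableTypeR R) -> \bar R)
    (B : set (measurableTypeR R)) : \bar R :=
  (moment (-1)%R pim *
   (lebesgue_measure \x lam)
     [set uz : measurableTypeR R * measurableTypeR R |
        [/\ 0 < uz.1, 0 < uz.2 & B (expR (- uz.1) * uz.2)]%R])%E.

Definition submultiplicative_on (R : realType) (D : set R) (g : R -> R) : Prop :=
  exists2 a, 0 < a &
    forall x y, D x -> D y -> g (x + y) <= a * g x * g y.

(* Differentiability on [a, +oo): one-sided at the endpoint. *)
Definition derivable_cy (R : realType) (f : R -> R) (a : R) : Prop :=
  {in `]a, +oo[, forall t, derivable f t 1} /\
  cvg (h^-1 *: (f (h + a) - f a) @[h --> 0^'+]).

(* Main.v *)
From HB Require Import structures.
Require Import Defs.
From mathcomp Require Import ring lra.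
From mathcomp Require finmap.
Local Open Scope classical_set_scope.
Local Open Scope ring_scope.

(** Write X(t) for the process, lambda-bar for the tail of lambda and g for the
inverse of f.

Part (i). A jump is visible in the path at the moment when it occurs:
X(tau) >= zeta at every point (xi, tau, zeta). The points with tau >= n and
zeta > K f(tau) have intensity pi((0, oo)) times the integral of
lambda-bar(K f) over [n, oo), which is infinite. So almost surely there is such
a point for every n, and X / f exceeds K at arbitrarily large times
([supou_limsup_ge]).

Part (ii). For n <= t < n + 1, the jumps up to time n have decayed further at
time t, and the jumps after n count at most with their full size. Hence
X(t) <= X(n) + Y_n, where Y_n is the sum of the jumps in the window (n, n + 1]
([supou_le_decayed_window]). Since f(n) <= f(t), it suffices that X(n) and Y_n
are both eventually at most L f(n); this is where the factor 2 comes from.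

Both are sums of T_n over the points of the Poisson random measure, for a
function T_n of a point such that the image of the intensity under T_n does not
depend on n: it is eta for X(n) ([decayed_jump_law], by the substitution
u = x (n - s)) and pi((0, oo)) lambda for Y_n ([window_jump_law]). The
theorem [poisson_sums_eventually_le] treats such sums Z_n. All Z_n have the law
of Z_0, so with G(y) = g(y / L) the sum of the probabilities of the events
{Z_n > L f(n)} = {G(Z_n) > n} is at most E G(Z_0), and by the Borel-Cantelli
lemma it suffices to bound a moment of submultiplicative type of Z_0. As for the
classical theorem on submultiplicative moments of infinitely divisible laws,
submultiplicativity gives a bound G(sum of y_j) <= C exp(sum of u(y_j)) with a
weight u that is linear for small jumps and ln(a G) for large jumps
([submultiplicative_sum_bound]). For the sum Phi_n of the weights over all
points, E exp(Phi_0) <= exp(integral of (e^u - 1)). This integral is finite: small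
jumps are summable, and for large jumps the integral of G is dominated by the
sum over n of the tails at L f(n), hence by the integral in the hypothesis
([log_weight_integrable]).

In fact only Phi_n is studied, not Z_n: {Z_n > L f(n)} is contained in
{n < C exp(Phi_n)}. Equality of laws ([random_integral_same_law]) and the
exponential moment ([poisson_simple_exp_moment]) are elementary when u is
replaced by a simple function, because the integral is then a finite linear
combination of independent Poisson variables, whose joint law is carried by a
countable set. Monotone convergence transfers the resulting bound on the sum of
probabilities to u ([random_integral_tail_series]). *)

Set Implicit Arguments.
Unset Strict Implicit.
Unset Printing Implicit Defensive.

(** * The Poisson law *)

Section poisson_law.
Context d (Omega : measurableType d) (R : realType) (P : probability Omega R).
Local Open Scope ereal_scope.

Lemma emeasurable_preimage1 d' (T : measurableType d') (N : T -> \bar R) x :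
  measurable_fun setT N -> measurable (N @^-1` [set x]).
Proof. by move=> mN; rewrite -[X in measurable X]setTI; apply: mN. Qed.

Lemma measurable_expeR : measurable_fun setT (@expeR R).
Proof.
move=> _; apply: (measurability _ (ErealGenOInfty.measurableE R)) => //.
move=> /= _ [_ [r ->] <-]; rewrite setTI preimage_itvoy.
have [r0|r0] := ltP r 0%R.
  rewrite (_ : [set _ | _] = setT)//; apply/seteqP; split=> // x _ /=.
  by rewrite (lt_le_trans _ (expeR_ge0 x))// lte_fin.
rewrite (_ : [set _ | _] = `]lne r%:E, +oo[%classic); first exact: emeasurable_itv.
have lr : expeR (lne r%:E) = r%:E by rewrite lneK// in_itv/= lee_fin r0 leey.
by apply/seteqP; split => x /=; rewrite in_itv/= andbT -[in r%:E < _]lr lte_expeR.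
Qed.

(** Encoding the values of a Poisson variable, +oo included, by a countable type
allows enumerating the joint values of a family of such variables. *)
Definition extended_nat (o : option nat) : \bar R :=
  if o is Some k then k%:R%:E else +oo.

Definition poisson_mass (c : \bar R) (o : option nat) : \bar R :=
  match c, o with
  | r%:E, Some k => poisson_prob r 0 [set k]
  | +oo, None => 1
  | _, _ => 0
  end.

Lemma poisson_distributed_mass (N : Omega -> \bar R) (c : \bar R)
    (o : option nat) :
  0 <= c -> measurable_fun setT N -> poisson_distributed P N c ->
  P (N @^-1` [set extended_nat o]) = poisson_mass c o.
Proof.
move=> c0 mN; case: c c0 => [r| |] //= r0 Npois; last first.
  case: o => [k|] /=; last first.
    by rewrite -Npois; congr (P _).
  have sub : N @^-1` [set k%:R%:E] `<=` ~` [set w | N w = +oo].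
    by move=> w /= ->.
  have mNy : measurable [set w | N w = +oo] by exact: emeasurable_preimage1.
  apply: (@subset_measure0 _ _ _ P _ _ _ _ sub).
  - exact: emeasurable_preimage1.
  - exact: measurableC.
  - by have := probability_setC P mNy; rewrite Npois subee.
case: o => [k|] /=.
  rewrite -Npois; congr (P _); apply/seteqP; split => w /=.
    by move=> Nw; exists k.
  by move=> [_ -> ->].
have sub : N @^-1` [set +oo] `<=`
    ~` [set w | exists2 k, [set: nat] k & N w = k%:R%:E].
  by move=> w /= -> [].
have mU : measurable [set w | exists2 k, [set: nat] k & N w = k%:R%:E].
  have -> : [set w | exists2 k, [set: nat] k & N w = k%:R%:E] =
      \bigcup_k (N @^-1` [set k%:R%:E]) by [].
  apply: bigcupT_measurable => k.
  exact: emeasurable_preimage1.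
apply: (@subset_measure0 _ _ _ P _ _ _ _ sub).
- exact: emeasurable_preimage1.
- exact: measurableC.
- by have := probability_setC P mU; rewrite Npois probability_setT subee.
Qed.

Lemma measurable_preimage_extended_nat (N : Omega -> \bar R) :
  measurable_fun setT N -> measurable (N @^-1` range extended_nat).
Proof.
move=> mN; have -> : N @^-1` range extended_nat =
    \bigcup_k (N @^-1` [set k%:R%:E]) `|` N @^-1` [set +oo].
  apply/seteqP; split => w /=.
    by move=> [[k|] _ Nw]; [left; exists k => //=; rewrite -Nw | right; rewrite -Nw].
  by move=> [[k _ /= Nw]|Nw]; [exists (Some k) | exists None].
apply: measurableU; first apply: bigcupT_measurable => k.
  exact: emeasurable_preimage1.
exact: emeasurable_preimage1.
Qed.

Lemma poisson_distributed_range (N : Omega -> \bar R) c :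
  measurable_fun setT N -> poisson_distributed P N c ->
  P (~` (N @^-1` range extended_nat)) = 0.
Proof.
move=> mN; have mrange := measurable_preimage_extended_nat mN.
case: c => [r| |] //= Npois.
  have := Npois setT; rewrite probability_setT => N1.
  rewrite probability_setC// (_ : P _ = 1) ?subee//; apply/eqP.
  rewrite eq_le probability_le1//= -N1 le_measure ?inE//.
    have -> : [set w | exists2 k, [set: nat] k & N w = k%:R%:E] =
      \bigcup_k (N @^-1` [set k%:R%:E]) by [].
    apply: bigcupT_measurable => k.
    exact: emeasurable_preimage1.
  by move=> w /= [k _ ->]; exists (Some k).
rewrite probability_setC// (_ : P _ = 1) ?subee//; apply/eqP.
rewrite eq_le probability_le1//= -Npois le_measure ?inE//.
  exact: emeasurable_preimage1.
by move=> w /= ->; exists None.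
Qed.

Lemma poisson_prob_set1 (r : R) k : (0 <= r)%R ->
  poisson_prob r 0 [set k] =
  (r ^+ k * k`!%:R^-1 * expR (- r))%:E.
Proof.
move=> r0; rewrite /poisson_prob; case: ifPn => r1.
  by rewrite esum_set1 ?lee_fin ?poisson_pmf_ge0// /poisson_pmf r1.
have -> : r = 0%R by apply/eqP; rewrite eq_le r0 leNgt r1.
rewrite diracE; case: k => [|k].
  by rewrite mem_set//= expr0 fact0 invr1 oppr0 expR0 !mulr1.
by rewrite memNset//= exprS !mul0r.
Qed.

(** Tilting by exp(v k) turns the Poisson weights of mean c into those of mean
c exp(v), up to the constant exp(c (exp(v) - 1)); the weights sum to 1. *)
Lemma poisson_exp_moment (N : Omega -> \bar R) (c v : R) : (0 <= c)%R ->
  measurable_fun setT N -> poisson_distributed P N c%:E ->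
  \int[P]_w expeR (v%:E * N w) = (expR (c * (expR v - 1)))%:E.
Proof.
move=> c0 mN Npois.
pose A k := N @^-1` [set k%:R%:E].
have mA k : measurable (A k).
  exact: emeasurable_preimage1.
have mF : measurable_fun setT (fun w => expeR (v%:E * N w)).
  apply: measurableT_comp; first exact: measurable_expeR.
  exact: measurable_funeM.
have mU : measurable (\bigcup_k A k) by exact: bigcupT_measurable.
have PU : P (~` \bigcup_k A k) = 0.
  by rewrite probability_setC// [P _](Npois setT) probability_setT subee.
rewrite (@ge0_negligible_integral _ _ _ P setT (~` \bigcup_k A k))//; last 2 first.
- exact: measurableC.
- by move=> w _; exact: expeR_ge0.
rewrite setTD setCK ge0_integral_bigcup//; last first.
- move=> i j _ _ [w [/= Ai Aj]].
  by move: Aj; rewrite /A/= Ai => -[] /eqP; rewrite eqr_nat => /eqP.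
- by move=> w _; exact: expeR_ge0.
- exact: measurable_funTS.
transitivity (\sum_(0 <= k <oo)
   ((expR (c * (expR v - 1)))%:E * poisson_prob (c * expR v)%R 0 [set k])).
  apply: eq_eseriesr => k _.
  rewrite (eq_integral (cst (expR (v * k%:R))%:E)); last first.
    by move=> w; rewrite inE => -> /=.
  rewrite integral_cst//= (@poisson_distributed_mass N _ (Some k) _ mN Npois)//=.
  rewrite !poisson_prob_set1 ?mulr_ge0 ?expR_ge0// -!EFinM; congr EFin.
  have -> : (expR (- c) = expR (c * (expR v - 1)) * expR (- (c * expR v)))%R.
    by rewrite -expRD; congr expR; ring.
  by rewrite expRM_natr exprMn; ring.
rewrite nneseriesZl//.
rewrite -[RHS]mule1; congr (_ * _).
rewrite -[RHS](@probability_setT _ _ _ (poisson_prob (c * expR v)%R 0)).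
have -> : [set: nat] = \bigcup_k [set k] by rewrite bigcup_imset1 image_id.
by rewrite measure_bigcup// => [|i j _ _ [w [/= -> ->]]]//;
  apply: eq_eseriesl => k; rewrite in_setT.
Qed.

End poisson_law.

(** * Expectations of products of independent variables *)

Section independence.
Context d (Omega : measurableType d) (R : realType) (P : probability Omega R).
Local Open Scope ereal_scope.
Import HBNNSimple.

(** Monotone class argument: a product formula that holds for the indicators of
N passes to simple functions by linearity and then to limits of increasing
sequences. *)
Lemma integral_comp_mul_of_indic d' (T : measurableType d') (N : Omega -> T)
    (U : Omega -> \bar R) (c : R) (F : T -> \bar R) :
  measurable_fun setT N -> measurable_fun setT U -> (forall w, 0 <= U w) ->
  (forall B, measurable B ->
     \int[P]_w ((\1_B (N w))%:E * U w) = c%:E * P (N @^-1` B)) ->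
  measurable_fun setT F -> (forall x, 0 <= F x) ->
  \int[P]_w (F (N w) * U w) = c%:E * \int[P]_w F (N w).
Proof.
move=> mN mU U0 NU mF F0.
have mNB B : measurable B -> measurable (N @^-1` B).
  by move=> mB; rewrite -[X in measurable X]setTI; exact: mN.
have simple (h : {nnsfun T >-> R}) :
    \int[P]_w ((h (N w))%:E * U w) = c%:E * \int[P]_w (h (N w))%:E.
  transitivity (\sum_(r \in range h)
      \int[P]_w (r%:E * ((\1_(h @^-1` [set r]) (N w))%:E * U w))).
    rewrite -ge0_integral_fsum//; last 2 first.
    - move=> r; apply: measurable_funeM; apply: emeasurable_funM => //.
      apply/measurable_EFinP; apply: measurableT_comp => //.
    - move=> r w _; have [r0|r0] := leP 0%R r.
        by rewrite mule_ge0 ?lee_fin// mule_ge0 ?lee_fin.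
      by rewrite preimage_nnfun0// indicE in_set0 mul0e mule0.
    apply: eq_integral => w _; rewrite {1}fimfunE -fsumEFin//.
    rewrite !fsbig_finite//= ge0_sume_distrl//.
      by apply: eq_bigr => r _; rewrite EFinM muleA.
    by move=> r _; rewrite EFinM nnfun_muleindic_ge0.
  transitivity (\sum_(r \in range h) (c%:E * (r%:E * P (N @^-1` (h @^-1` [set r]))))).
    apply: eq_fsbigr => r _; have [r0|r0] := leP 0%R r; last first.
      rewrite preimage_nnfun0// preimage_set0 measure0 !mule0.
      by apply: integral0_eq => w _; rewrite indicE in_set0 mul0e mule0.
    rewrite ge0_integralZl//; last 2 first.
    - apply: emeasurable_funM => //.
      by apply/measurable_EFinP; apply: measurableT_comp.
    - by move=> w _; rewrite mule_ge0 ?lee_fin.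
    by rewrite NU// muleCA.
  rewrite !fsbig_finite//= -ge0_sume_distrr//; last first.
    move=> r _; have [r0|r0] := leP 0%R r; first by rewrite mule_ge0 ?lee_fin.
    by rewrite preimage_nnfun0// preimage_set0 measure0 mule0.
  congr (_ * _).
  rewrite (_ : (fun w => (h (N w))%:E) = (fun w => \sum_(r \in range h)
     (r * \1_(N @^-1` (h @^-1` [set r])) w)%:E)); last first.
    by apply/funext => w; rewrite {1}fimfunE -fsumEFin.
  rewrite ge0_integral_fsum//; last 2 first.
  - move=> r; apply/measurable_EFinP; apply: measurable_funM => //.
    by apply: measurable_indic; exact: mNB.
  - move=> r w _; have [r0|r0] := leP 0%R r; first by rewrite lee_fin mulr_ge0.
    by rewrite preimage_nnfun0// preimage_set0 indicE in_set0 mulr0.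
  rewrite fsbig_finite//=; apply: eq_bigr => r _.
  have [r0|r0] := leP 0%R r; last first.
    rewrite preimage_nnfun0// preimage_set0 measure0 mule0.
    by rewrite integral0_eq// => w _; rewrite indicE in_set0 mulr0.
  under eq_integral do rewrite EFinM.
  rewrite ge0_integralZl//; last first.
    by apply/measurable_EFinP; apply: measurable_indic; exact: mNB.
  by rewrite integral_indic ?setIT//; exact: mNB.
pose g := nnsfun_approx measurableT mF.
have gF x : (g n x)%:E @[n --> \oo] --> F x.
  by apply: (cvg_nnsfun_approx measurableT mF) => // y _; exact: F0.
have g_nd x : {homo (fun n => g n x) : n m / (n <= m)%N >-> (n <= m)%R}.
  by move=> n m nm; exact/lefP/nd_nnsfun_approx.
have lhs : \int[P]_w ((g n (N w))%:E * U w) @[n --> \oo] -->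
    \int[P]_w (F (N w) * U w).
  have -> : (fun w => F (N w) * U w) =
      (fun w => limn (fun n => (g n (N w))%:E * U w)).
    apply/funext => w; apply/esym/cvg_lim => //.
    (* [U w] or [F (N w)] may be 0 while the other one is +oo: these two cases
       are not covered by the continuity of the product. *)
    have [/eqP->|U_neq0] := boolP (U w == 0).
      by rewrite mule0; under eq_fun do rewrite mule0; exact: cvg_cst.
    have [/eqP Fw|F_neq0] := boolP (F (N w) == 0).
      suff gw n : (g n (N w))%:E = 0.
        by rewrite Fw mul0e; under eq_fun do rewrite gw mul0e; exact: cvg_cst.
      apply/eqP; rewrite eq_le [in X in _ && X]lee_fin fun_ge0 andbT -Fw.
      rewrite -(cvg_lim _ (gF (N w)))//; apply: lime_ge.
        by apply/cvg_ex; exists (F (N w)).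
      by exists n => // m /= nm; rewrite lee_fin g_nd.
    apply: cvgeM => //; last exact: cvg_cst.
    by rewrite mule_defE (negbTE F_neq0) (negbTE U_neq0).
  apply: cvg_monotone_convergence => //.
  - move=> n; apply: emeasurable_funM => //.
    by apply/measurable_EFinP; apply: measurableT_comp.
  - by move=> n w _; rewrite mule_ge0 ?lee_fin.
  - by move=> w _ n m nm; rewrite lee_wpmul2r// lee_fin g_nd.
have rhs : \int[P]_w (g n (N w))%:E @[n --> \oo] --> \int[P]_w F (N w).
  have -> : (fun w => F (N w)) = (fun w => limn (fun n => (g n (N w))%:E)).
    by apply/funext => w; apply/esym/cvg_lim => //; exact: gF.
  apply: cvg_monotone_convergence => //.
  - by move=> n; apply/measurable_EFinP; apply: measurableT_comp.
  - by move=> n w _; rewrite lee_fin.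
  - by move=> w _ n m nm; rewrite lee_fin g_nd.
apply: (cvg_unique _ lhs) => //.
rewrite (_ : (fun n => _) = (fun n => c%:E * \int[P]_w (g n (N w))%:E)).
  by apply: cvgeZl.
by apply/funext => n; exact: simple.
Qed.

Lemma emeasurable_prod I (s : seq I) d' (T : measurableType d') (h : I -> T -> \bar R)
    (p : pred I) :
  (forall i, measurable_fun setT (h i)) ->
  measurable_fun setT (fun x => \prod_(i <- s | p i) h i x).
Proof.
move=> mh; elim: s => [|i s IH].
  by under eq_fun do rewrite big_nil; exact: measurable_cst.
under eq_fun do rewrite big_cons.
by case: (p i) => //; apply: emeasurable_funM.
Qed.

(** For indicators this is the definition of independence. Arbitrary functions
are then admissible in one more coordinate at a time: when the other factors are
fixed, the formula for all indicators in that coordinate extends by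
[integral_comp_mul_of_indic]. *)
Lemma integral_prod_independent n (N : 'I_n -> Omega -> \bar R)
    (F : 'I_n -> \bar R -> \bar R) :
  (forall i, measurable_fun setT (N i)) -> mutually_independent P N ->
  (forall i, measurable_fun setT (F i)) -> (forall i x, 0 <= F i x) ->
  (forall i, \int[P]_w F i (N i w) \is a fin_num) ->
  \int[P]_w (\prod_(i < n) F i (N i w)) = \prod_(i < n) \int[P]_w F i (N i w).
Proof.
move=> mN indep.
have mNB i B : measurable B -> measurable (N i @^-1` B).
  by move=> mB; rewrite -[X in measurable X]setTI; exact: mN.
suff indicators j : (j <= n)%N -> forall F : 'I_n -> \bar R -> \bar R,
    (forall i, measurable_fun setT (F i)) -> (forall i x, 0 <= F i x) ->
    (forall i, \int[P]_w F i (N i w) \is a fin_num) ->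
    (forall i : 'I_n, (j <= i)%N ->
       exists2 B, measurable B & F i = EFin \o \1_B) ->
    \int[P]_w (\prod_(i < n) F i (N i w)) = \prod_(i < n) \int[P]_w F i (N i w).
  move=> mF F0 Ffin; apply: (indicators n) => // i.
  by rewrite leqNgt ltn_ord.
(* In [indicators], the coordinates from [j] on still carry indicators. *)
elim: j => [_ {}F mF F0 Ffin Findic|j IH jn {}F mF F0 Ffin Findic].
  have /choice[S SP] : forall i, exists B,
      measurable B /\ F i = EFin \o \1_B.
    move=> i; by have [B mB FB] := Findic i (leq0n i); exists B.
  have mS i : measurable (S i) by have [] := SP i.
  have FS i : F i = EFin \o \1_(S i) by have [] := SP i.
  transitivity (\int[P]_w (\1_(\bigcap_(i in [set: 'I_n]) (N i @^-1` S i)) w)%:E).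
    apply: eq_integral => w _; rewrite indicE.
    have [wS|wS] := boolP (w \in _).
      apply: big1 => i _; rewrite FS/= indicE mem_set//.
      by move: wS; rewrite inE; apply.
    have /existsNP[i NSi] : ~ (forall i, S i (N i w)).
      by move=> wS'; move: wS; rewrite notin_setE; apply => i _; exact: wS'.
    by rewrite (bigD1 i)//= FS/= indicE memNset// mul0e.
  rewrite integral_indic//; last first.
    by apply: fin_bigcap_measurable => // i _; exact: mNB.
  rewrite setIT; apply: (etrans (indep S mS)); apply: eq_bigr => i _.
  rewrite FS/= (_ : (fun w => _) = (fun w => (\1_(N i @^-1` S i) w)%:E))//.
  by rewrite integral_indic ?setIT//; exact: mNB.
pose j' := Ordinal jn.
pose U w := \prod_(i < n | i != j') F i (N i w).
have mU : measurable_fun setT U.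
  by apply: emeasurable_prod => i; exact: measurableT_comp.
have U0 w : 0 <= U w by apply: prode_ge0 => i _.
pose c := \prod_(i < n | i != j') \int[P]_w F i (N i w).
have cE : c = (fine c)%:E.
  by rewrite fineK//; apply: prode_fin_num => i _; exact: Ffin.
rewrite [RHS](bigD1 j')//= -/c muleC cE.
under eq_integral do rewrite (bigD1 j')//= -/(U _).
apply: integral_comp_mul_of_indic => // B mB; rewrite -cE.
pose F' i := if i == j' then EFin \o \1_B else F i.
have mF' i : measurable_fun setT (F' i).
  by rewrite /F'; case: ifP => // _; apply/measurable_EFinP/measurable_indic.
have F'j w : \prod_(i < n) F' i (N i w) = (\1_B (N j' w))%:E * U w.
  rewrite (bigD1 j')//= {1}/F' eqxx; congr (_ * _).
  by apply: eq_bigr => i /negbTE ij; rewrite /F' ij.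
have PB : \int[P]_w F' j' (N j' w) = P (N j' @^-1` B).
  rewrite /F' eqxx/= (_ : (fun w => _) = (fun w => (\1_(N j' @^-1` B) w)%:E))//.
  by rewrite integral_indic ?setIT//; exact: mNB.
under eq_integral do rewrite -F'j.
rewrite IH//; last 4 first.
- exact: ltnW.
- by move=> i x; rewrite /F'; case: ifP => //= _; rewrite lee_fin.
- move=> i; have [->|ij] := eqVneq i j'.
    by rewrite PB fin_num_measure//; exact: mNB.
  by rewrite /F' (negbTE ij).
- move=> i ji; rewrite /F'; case: ifP => [_|/negbT ij]; first by exists B.
  apply: Findic; rewrite ltn_neqAle ji andbT eq_sym.
  by apply: contraNneq ij => ij; apply/eqP/val_inj.
rewrite (bigD1 j')//= PB muleC; congr (_ * _).
by apply: eq_bigr => i /negbTE ij; rewrite /F' ij.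
Qed.

End independence.

(** * The joint law of independent Poisson variables *)

Section poisson_families.
Context d (Omega : measurableType d) (R : realType) (P : probability Omega R).
Local Open Scope ereal_scope.

(** Mass that a product of Poisson laws of means [c i] gives to the [j]-th point of
a fixed enumeration of the joint values, if this point satisfies [G]. The family
of variables does not occur, so that two families with the same means are
comparable by rewriting. *)
Definition poisson_family_mass n (c : 'I_n -> \bar R)
    (G : ('I_n -> \bar R) -> Prop) (j : nat) : \bar R :=
  if pickle_inv j is Some kappa then
    if `[< G (fun i => extended_nat R ((kappa : {ffun 'I_n -> option nat}) i)) >]
    then \prod_(i < n) poisson_mass (c i) (kappa i) else 0
  else 0.

(** Almost surely all [N i] take values in a countable set, so the law of the
family is determined by its atoms, whose masses are products by
independence. *)
Lemma poisson_family_law n (N : 'I_n -> Omega -> \bar R) (c : 'I_n -> \bar R)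
    (G : ('I_n -> \bar R) -> Prop) :
  (forall i, 0 <= c i) -> (forall i, measurable_fun setT (N i)) ->
  (forall i, poisson_distributed P (N i) (c i)) -> mutually_independent P N ->
  measurable [set w | G (N ^~ w)] ->
  P [set w | G (N ^~ w)] = \sum_(j <oo) poisson_family_mass c G j.
Proof.
move=> c0 mN Npois indep mG.
pose atom (kappa : {ffun 'I_n -> option nat}) :=
  \bigcap_(i in [set: 'I_n]) (N i @^-1` [set extended_nat R (kappa i)]).
have matom kappa : measurable (atom kappa).
  by apply: fin_bigcap_measurable => // i _; exact: emeasurable_preimage1.
have Patom kappa : P (atom kappa) = \prod_(i < n) poisson_mass (c i) (kappa i).
  rewrite [LHS](indep (fun i => [set extended_nat R (kappa i)])); last first.
    by move=> i; exact: emeasurable_set1.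
  by apply: eq_bigr => i _; exact: poisson_distributed_mass.
pose F (j : nat) : set Omega := if pickle_inv j is Some kappa then
  if `[< G (fun i => extended_nat R ((kappa : {ffun 'I_n -> option nat}) i)) >]
  then atom kappa else set0 else set0.
have mF j : measurable (F j).
  by rewrite /F; case: pickle_inv => // kappa; case: ifP.
have PF j : P (F j) = poisson_family_mass c G j.
  rewrite /F /poisson_family_mass; case: pickle_inv => [kappa|]; last exact: measure0.
  by case: ifP => // _; exact: measure0.
have en_inj : injective (extended_nat R).
  move=> [k|] [l|] //= [] /eqP; rewrite eqr_nat => /eqP -> //.
have tF : trivIset setT F.
  move=> j k _ _ [w []]; rewrite /F.
  case jE : (pickle_inv j) => [kappa|]; last by case.
  case: ifP => // _ wj; case kE : (pickle_inv k) => [iota|]; last by case.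
  case: ifP => // _ wk.
  have kappaE : kappa = iota.
    apply/ffunP => i; apply: en_inj.
    by rewrite -[LHS](wj i I) -[RHS](wk i I).
  have := pickle_invK (T := {ffun 'I_n -> option nat}) j.
  have := pickle_invK (T := {ffun 'I_n -> option nat}) k.
  by rewrite jE kE /= kappaE => -> ->.
have mFU : measurable (\bigcup_j F j) by exact: bigcupT_measurable.
have FG : \bigcup_j F j `<=` [set w | G (N ^~ w)].
  move=> w [j _]; rewrite /F; case: pickle_inv => [kappa|//].
  case: asboolP => // Gkappa wkappa; rewrite /=.
  have -> : N ^~ w = (fun i => extended_nat R (kappa i)).
    by apply/funext => i; exact: wkappa.
  exact: Gkappa.
have negl : P.-negligible ([set w | G (N ^~ w)] `\` \bigcup_j F j).
  pose Z (k : nat) :=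
    [set w | exists2 i : 'I_n, i = k :> nat & ~ range (extended_nat R) (N i w)].
  have nZ k : P.-negligible (Z k).
    have [kn|kn] := ltnP k n; last first.
      rewrite (_ : Z k = set0); first exact: negligible_set0.
      by rewrite -subset0 => w [i ik]; move: (ltn_ord i); rewrite ik ltnNge kn.
    apply: (@negligibleS _ _ _ P (~` (N (Ordinal kn) @^-1` range (extended_nat R)))).
      by move=> w [i ik]; rewrite (_ : i = Ordinal kn)//; exact: val_inj.
    apply/negligibleP.
      apply: measurableC.
      exact: measurable_preimage_extended_nat.
    exact: poisson_distributed_range (mN _) (Npois _).
  apply: negligibleS (negligible_bigcup nZ) => w [/= Gw NF].
  apply: contrapT => NZ; apply: NF.
  have /choice[kappa kappaE] : forall i, exists o, extended_nat R o = N i w.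
    move=> i; have : range (extended_nat R) (N i w).
      by apply: contrapT => Ni; apply: NZ; exists i => //; exists i.
    by move=> [u _ <-]; exists u.
  exists (pickle (finfun kappa)) => //; rewrite /F pickleK_inv.
  have NE : N ^~ w = (fun i => extended_nat R ((finfun kappa) i)).
    by apply/funext => i; rewrite ffunE kappaE.
  rewrite asboolT; last by rewrite -NE.
  by move=> i _; rewrite /= ffunE kappaE.
transitivity (P (\bigcup_j F j)).
  have -> := measureDI P mG mFU.
  rewrite (measure_negligible _ negl); last exact: measurableD.
  by rewrite add0e setIidr.
rewrite measure_bigcup//; rewrite (eq_eseriesl _ _ (Q := xpredT)).
  by apply: eq_eseriesr => j _; exact: PF.
by move=> j; rewrite in_setT.
Qed.

End poisson_families.

(** * Exponential moments of simple Poisson integrals *)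

Section level_sets.
Import HBNNSimple finmap.
Context d (T : measurableType d) (R : realType).
Local Open Scope ereal_scope.

(** The levels depend on [h] only, not on the measure [m], the map [t] or the
function [g]. So the integrals of [h] composed with several maps [t], against a
random measure and against its intensity, are all expressed by the same
coefficients [v i] and corresponding level sets. *)
Lemma nnsfun_level_sets (h : {nnsfun T >-> R}) :
  exists n, exists v : 'I_n -> R,
    [/\ forall i, (0 < v i)%R, injective v &
        forall d' (E : measurableType d') (t : E -> T) (g : R -> R)
            (m : {measure set E -> \bar R}), measurable_fun setT t ->
          g 0%R = 0%R -> (forall i, (0 <= g (v i))%R) ->
        \int[m]_x (g (h (t x)))%:E =
        \sum_(i < n) (g (v i))%:E * m (t @^-1` (h @^-1` [set v i]))].
Proof.
have fin_range : finite_set (range h) by exact: fimfunP.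
pose s := seq.filter (fun x : R => (0 < x)%R) (finmap.enum_fset (fset_set (range h))).
have us : uniq s by apply: filter_uniq; exact: finmap.fset_uniq.
have mem_s x : x \in s = (0 < x)%R && `[< range h x >].
  rewrite mem_filter; congr (_ && _).
  rewrite -[LHS]/(x \in fset_set (range h)) in_fset_set//.
exists (size s), (fun i => nth 0%R s i).
split=> [i|i j /eqP|d' E t g m mt g0 gv].
- by have := mem_nth 0%R (ltn_ord i); rewrite mem_s => /andP[].
- by rewrite nth_uniq// => /eqP; exact: val_inj.
have mB i : measurable (t @^-1` (h @^-1` [set nth 0%R s i])).
  rewrite -[X in measurable X]setTI; apply: mt => //.
rewrite (eq_integral (fun x => \sum_(i < size s)
    (g (nth 0%R s i))%:E * (\1_(t @^-1` (h @^-1` [set nth 0%R s i])) x)%:E)); last first.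
  move=> x _; have [hx0|hx0] := eqVneq (h (t x)) 0%R.
    rewrite hx0 g0 big1// => i _; rewrite indicE memNset ?mule0//= hx0.
    by apply/eqP; rewrite lt_eqF//; have := mem_nth 0%R (ltn_ord i);
      rewrite mem_s => /andP[].
  have hxs : h (t x) \in s.
    by rewrite mem_s lt_neqAle eq_sym hx0 fun_ge0/=; apply/asboolP; exists (t x).
  have hxi : (index (h (t x)) s < size s)%N by rewrite index_mem.
  rewrite (bigD1 (Ordinal hxi))//= nth_index// indicE mem_set//= mule1.
  rewrite big1 ?adde0// => i; rewrite -val_eqE/= => ix.
  rewrite indicE memNset ?mule0//= => hxE; move/eqP: ix; apply.
  by rewrite hxE index_uniq.
rewrite ge0_integral_sum//; last 2 first.
- move=> i; apply: measurable_funeM; apply/measurable_EFinP.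
  exact: measurable_indic.
- by move=> i x _; rewrite mule_ge0// lee_fin// gv.
apply: eq_bigr => i _; rewrite ge0_integralZl//; last 2 first.
- by apply/measurable_EFinP; exact: measurable_indic.
- by rewrite lee_fin gv.
by rewrite integral_indic ?setIT.
Qed.

End level_sets.

Lemma sum_lt_le (R : realType) (y : R) K : 0 <= y ->
  \sum_(k < K) ((k.+1%:R < y)%R : nat)%:R <= y.
Proof.
move=> y0; elim: K => [|K IH]; first by rewrite big_ord0.
have [Ky|Ky] := ltP K.+1%:R y; last first.
  by rewrite big_ord_recr/= ltNge Ky/= addr0.
apply: le_trans (ltW Ky); elim: K.+1 => [|j IHj]; first by rewrite big_ord0.
by rewrite big_ord_recr/= -natr1 lerD// lern1 leq_b1.
Qed.

Section poisson_functionals.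
Context d (Omega : measurableType d) (R : realType) (P : probability Omega R).
Context d' (E : measurableType d') (nu : {measure set E -> \bar R})
  (mu : Omega -> {measure set E -> \bar R}).
Hypothesis prm : poisson_random_measure P nu mu.
Local Open Scope ereal_scope.

(** Independence on disjoint sets factors the expectation into exponential moments
of Poisson variables. If some [B i] has infinite intensity, the right-hand side
is +oo. *)
Lemma poisson_simple_exp_moment n (B : 'I_n -> set E) (v : 'I_n -> R) :
  (forall i, (0 < v i)%R) -> (forall i, measurable (B i)) -> trivIset setT B ->
  \int[P]_w expeR (\sum_(i < n) (v i)%:E * mu w (B i)) <=
  expeR (\sum_(i < n) (expR (v i) - 1)%:E * nu (B i)).
Proof.
move=> v0 mB tB; have [mmu poismu indep] := prm.
have ev i : (0 < expR (v i) - 1)%R by rewrite subr_gt0 expR_gt1.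
have [[i nui]|nuB] := pselect (exists i, nu (B i) = +oo).
  rewrite (bigD1 i)//= nui gt0_muley ?lte_fin// addye; first exact: leey.
  rewrite gt_eqF// (lt_le_trans ltNy0)// sume_ge0// => j _.
  by rewrite mule_ge0// lee_fin ltW.
have nufin i : nu (B i) = (fine (nu (B i)))%:E.
  rewrite fineK// ge0_fin_numE// ltey; apply/eqP => nui; apply: nuB.
  by exists i.
have expi i : \int[P]_w expeR ((v i)%:E * mu w (B i)) =
    (expR (fine (nu (B i)) * (expR (v i) - 1)))%:E.
  apply: poisson_exp_moment; first by rewrite fine_ge0.
    exact: mmu.
  by have := poismu _ (mB i); rewrite nufin.
have expeR_sum (a : 'I_n -> \bar R) :
    expeR (\sum_(i < n) a i) = \prod_(i < n) expeR (a i).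
  by apply: (big_morph expeR (@expeRD R) expeR0).
under eq_integral do rewrite expeR_sum.
rewrite (integral_prod_independent (F := fun i x => expeR ((v i)%:E * x))
    (N := fun i w => mu w (B i))).
- rewrite expeR_sum; rewrite le_eqVlt; apply/orP; left; apply/eqP; apply: eq_bigr => i _.
  by rewrite expi nufin -EFinM/= mulrC.
- by move=> i; exact: mmu.
- exact: indep.
- by move=> i; apply: measurableT_comp; [exact: measurable_expeR | exact: measurable_funeM].
- by move=> i x; exact: expeR_ge0.
- by move=> i; rewrite expi.
Qed.

End poisson_functionals.

(** * Integrals against a Poisson random measure *)

Section poisson_functionals_law.
Context d (Omega : measurableType d) (R : realType) (P : probability Omega R).
Context d' (E : measurableType d') (nu : {measure set E -> \bar R})
  (mu : Omega -> {measure set E -> \bar R}).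
Hypothesis prm : poisson_random_measure P nu mu.
Local Open Scope ereal_scope.
Import HBNNSimple.

(** The integral of a simple function is a finite combination of the measurable
functions [mu w B]. *)
Lemma measurable_random_integral (phi : E -> \bar R) :
  measurable_fun setT phi -> (forall e, 0 <= phi e) ->
  measurable_fun setT (fun w => \int[mu w]_e phi e).
Proof.
have [mmu _ _] := prm => mphi phi0.
pose g := nnsfun_approx measurableT mphi.
apply: (emeasurable_fun_cvg (fun n w => \int[mu w]_e (g n e)%:E)).
  move=> n; have [m [v [v0 _ levels]]] := nnsfun_level_sets (g n).
  have -> : (fun w => \int[mu w]_e (g n e)%:E) =
      (fun w => \sum_(i < m) (v i)%:E * mu w (g n @^-1` [set v i])).
    apply/funext => w; apply: (levels _ E id id (mu w)) => // i.
    exact: ltW.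
  apply: emeasurable_sum => i; apply: measurable_funeM; exact: mmu.
move=> w _; have -> : (fun e => phi e) = (fun e => limn (fun n => (g n e)%:E)).
  apply/funext => e; apply/esym/cvg_lim => //.
  exact: (cvg_nnsfun_approx measurableT mphi).
apply: cvg_monotone_convergence => //.
- by move=> n; apply/measurable_EFinP.
- by move=> n e _; rewrite lee_fin.
- by move=> e _ n m nm; rewrite lee_fin; exact/lefP/nd_nnsfun_approx.
Qed.

Variable T : nat -> E -> R.
Hypothesis mT : forall k, measurable_fun setT (T k).
Hypothesis lawT : forall k (B : set R), measurable B -> B `<=` `]0%R, +oo[ ->
  nu (T k @^-1` B) = nu (T 0%N @^-1` B).

Let mlt (phi : E -> \bar R) (x : \bar R) :
  measurable_fun setT phi -> (forall e, 0 <= phi e) ->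
  measurable [set w | x < \int[mu w]_e phi e].
Proof.
move=> mphi phi0; rewrite -[X in measurable X]setTI.
by apply: emeasurable_fun_o_infty => //; exact: measurable_random_integral.
Qed.

(** The integrals of [h] composed with [T k] and with [T 0] are the same linear
combination of two independent Poisson families. Since [h] vanishes off
(0, oo), the level sets of [h] lie there, and by [lawT] the two families have the
same means. *)
Lemma random_integral_same_law (h : {nnsfun R >-> R}) (x : \bar R) k :
  (forall y, (y <= 0)%R -> h y = 0%R) ->
  P [set w | x < \int[mu w]_e (h (T k e))%:E] =
  P [set w | x < \int[mu w]_e (h (T 0%N e))%:E].
Proof.
move=> h0; have [mmu poismu indep] := prm.
have [n [v [v0 vinj levels]]] := nnsfun_level_sets h.
have mhv j i : measurable (T j @^-1` (h @^-1` [set v i])).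
  by rewrite -[X in measurable X]setTI; exact: mT.
have hT j w : \int[mu w]_e (h (T j e))%:E =
    \sum_(i < n) (v i)%:E * mu w (T j @^-1` (h @^-1` [set v i])).
  by apply: (levels _ E (T j) id (mu w)) => // i; exact: ltW.
have law j : P [set w | x < \int[mu w]_e (h (T j e))%:E] =
    \sum_(l <oo) poisson_family_mass (fun i => nu (T 0%N @^-1` (h @^-1` [set v i])))
      (fun a => x < \sum_(i < n) (v i)%:E * a i) l.
  have -> : [set w | x < \int[mu w]_e (h (T j e))%:E] =
      [set w | x < \sum_(i < n) (v i)%:E * mu w (T j @^-1` (h @^-1` [set v i]))].
    by apply/seteqP; split => w /=; rewrite hT.
  apply: (poisson_family_law (N := fun i w => mu w (T j @^-1` (h @^-1` [set v i])))
    (G := fun a : 'I_n -> \bar R => x < \sum_(i < n) (v i)%:E * a i)) => //.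
  - by move=> i; exact: mmu.
  - move=> i; rewrite -(lawT j); [exact: poismu| | ].
      by [].
    move=> y /= hy; rewrite in_itv/= andbT ltNge; apply/negP => /h0.
    by rewrite hy => v0'; have := v0 i; rewrite v0' ltxx.
  - apply: indep => // i1 i2 _ _ [e [/= e1 e2]].
    by apply: vinj; rewrite -e1 -e2.
  - under eq_set do rewrite -hT.
    apply: mlt; last by move=> e; rewrite lee_fin.
    by apply/measurable_EFinP; exact: measurableT_comp.
by rewrite !law.
Qed.

(** By equality of laws, [T k] may be replaced by [T 0], with integral H. At most
C exp(H) of the thresholds ln((k + 1) / C) lie below H, so the sum of the
probabilities is at most C E exp(H). *)
Lemma random_integral_tail_sum (h : {nnsfun R >-> R}) (C : R) K :
  (0 < C)%R -> (forall y, (y <= 0)%R -> h y = 0%R) ->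
  \sum_(k < K) P [set w | (ln (k.+1%:R / C))%:E < \int[mu w]_e (h (T k e))%:E] <=
  C%:E * expeR (\int[nu]_e (expR (h (T 0%N e)) - 1)%:E).
Proof.
move=> C0 h0; under eq_bigr do rewrite random_integral_same_law//.
have [n [v [v0 vinj levels]]] := nnsfun_level_sets h.
pose B i := T 0%N @^-1` (h @^-1` [set v i]).
have mB i : measurable (B i).
  by rewrite -[X in measurable X]setTI; exact: mT.
have mh : measurable_fun setT (fun e => (h (T 0%N e))%:E).
  by apply/measurable_EFinP; exact: measurableT_comp.
have h_ge0 e : 0 <= (h (T 0%N e))%:E by rewrite lee_fin.
pose H w := \int[mu w]_e (h (T 0%N e))%:E.
have mH : measurable_fun setT H by exact: measurable_random_integral.
have -> : \int[nu]_e (expR (h (T 0%N e)) - 1)%:E =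
    \sum_(i < n) (expR (v i) - 1)%:E * nu (B i).
  apply: (levels _ E (T 0%N) (fun x => expR x - 1)%R nu) => //.
    by rewrite expR0 subrr.
  by move=> i; rewrite subr_ge0 ltW// expR_gt1.
have mHk k : measurable [set w | (ln (k.+1%:R / C))%:E < H w] by exact: mlt.
apply: (@le_trans _ _ (\int[P]_w (C%:E * expeR (H w)))).
  under eq_bigr do rewrite -[X in P X]setIT -(integral_indic P measurableT)//.
  rewrite -ge0_integral_sum//; last first.
    by move=> k; apply/measurable_EFinP; exact: measurable_indic.
  apply: ge0_le_integral => //.
  - by move=> w _; apply: sume_ge0 => k _; rewrite lee_fin.
  - by apply: emeasurable_sum => k; apply/measurable_EFinP; exact: measurable_indic.
  - by apply: measurable_funeM; apply: measurableT_comp => //; exact: measurable_expeR.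
  move=> w _; rewrite sumEFin.
  have H0 : 0 <= H w by exact: integral_ge0.
  case HE : (H w) H0 => [y| |//] y0; last by rewrite gt0_muley ?lte_fin ?leey.
  rewrite -EFinM lee_fin; apply: le_trans (sum_lt_le K _); last first.
    by rewrite mulr_ge0 ?expR_ge0 ?ltW.
  apply: ler_sum => k _; rewrite indicE ler_nat.
  case: (boolP (w \in _)) => // /set_mem; rewrite /= -/(H w) HE lte_fin => lny.
  rewrite (_ : (_ < _)%R = true)// mulrC -ltr_pdivrMr//.
  rewrite -ltr_expR lnK// in lny.
  by rewrite posrE divr_gt0.
rewrite ge0_integralZl//; last 3 first.
- by apply: measurableT_comp => //; exact: measurable_expeR.
- by move=> w _; exact: expeR_ge0.
- by rewrite lee_fin ltW.
rewrite lee_pmul2l ?lte_fin//.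
have HE w : H w = \sum_(i < n) (v i)%:E * mu w (B i).
  by apply: (levels _ E (T 0%N) id (mu w)) => // i; exact: ltW.
under eq_integral do rewrite HE.
apply: (poisson_simple_exp_moment prm) => // i1 i2 _ _ [e [/= e1 e2]].
by apply: vinj; rewrite -e1 -e2.
Qed.

(** Both sides of [random_integral_tail_sum] pass to the limit along simple
functions increasing to [u]; the events in the sum increase, because the
thresholds are exceeded strictly. *)
Lemma random_integral_tail_series (u : R -> R) (C : R) :
  measurable_fun setT u -> (forall y, 0 <= u y)%R ->
  (forall y, (y <= 0)%R -> u y = 0%R) -> (0 < C)%R ->
  \sum_(k <oo) P [set w | (ln (k.+1%:R / C))%:E < \int[mu w]_e (u (T k e))%:E] <=
  C%:E * expeR (\int[nu]_e (expR (u (T 0%N e)) - 1)%:E).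
Proof.
move=> mu_ u0 u_le0 C0.
have mEu : measurable_fun setT (EFin \o u) by exact/measurable_EFinP.
pose g := nnsfun_approx measurableT mEu.
have gu y : (g n y)%:E @[n --> \oo] --> (u y)%:E.
  by apply: (cvg_nnsfun_approx measurableT mEu) => // z _; rewrite lee_fin.
have g_nd y : {homo (fun n => g n y) : n m / (n <= m)%N >-> (n <= m)%R}.
  by move=> n m nm; exact/lefP/nd_nnsfun_approx.
have g_le n y : (g n y <= u y)%R.
  rewrite -lee_fin -(cvg_lim _ (gu y))//; apply: lime_ge.
    by apply/cvg_ex; exists (u y)%:E.
  by exists n => // m /= nm; rewrite lee_fin g_nd.
have g0 n y : (y <= 0)%R -> g n y = 0%R.
  by move=> y0; apply/eqP; rewrite eq_le fun_ge0 andbT -(u_le0 _ y0) g_le.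
pose A n k := [set w | (ln (k.+1%:R / C))%:E < \int[mu w]_e (g n (T k e))%:E].
pose A' k := [set w | (ln (k.+1%:R / C))%:E < \int[mu w]_e (u (T k e))%:E].
have mgT n k : measurable_fun setT (fun e => (g n (T k e))%:E).
  by apply/measurable_EFinP; exact: measurableT_comp.
have muT k : measurable_fun setT (fun e => (u (T k e))%:E).
  by apply/measurable_EFinP; exact: measurableT_comp.
have mA n k : measurable (A n k) by apply: mlt => // e; rewrite lee_fin.
have mA' k : measurable (A' k) by apply: mlt => // e; rewrite lee_fin.
have int_nd k w : {homo (fun n => \int[mu w]_e (g n (T k e))%:E) :
    n m / (n <= m)%N >-> n <= m}.
  move=> n m nm; apply: ge0_le_integral => //.
  - by move=> e _; rewrite lee_fin.
  - by move=> e _; rewrite lee_fin g_nd.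
have AA' k : P (A n k) @[n --> \oo] --> P (A' k).
  have -> : A' k = \bigcup_n A n k.
    apply/seteqP; split => w /=; rewrite /A' /A /=.
      have -> : \int[mu w]_e (u (T k e))%:E =
          limn (fun n => \int[mu w]_e (g n (T k e))%:E).
        apply/esym/cvg_lim => //.
        have -> : (fun e => (u (T k e))%:E) = (fun e => limn (fun n => (g n (T k e))%:E)).
          by apply/funext => e; apply/esym/cvg_lim.
        apply: cvg_monotone_convergence => //.
        - by move=> n e _; rewrite lee_fin.
        - by move=> e _ n m nm; rewrite lee_fin g_nd.
      move=> xlim; apply: contrapT => /forall2NP xn.
      move: xlim; rewrite ltNge => /negP; apply; apply: lime_le.
        exact: ereal_nondecreasing_is_cvgn.
      by apply: nearW => n; case: (xn n) => [[]//|] /negP; rewrite -leNgt.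
    move=> [n _ /= xn]; apply: lt_le_trans xn _; apply: ge0_le_integral => //.
    - by move=> e _; rewrite lee_fin.
    - by move=> e _; rewrite lee_fin.
  apply: nondecreasing_cvg_mu => //; first exact: bigcupT_measurable.
  move=> n m nm; apply/subsetPset => w; rewrite /A/= => /lt_le_trans; apply.
  exact: int_nd.
apply: lime_le; first by apply: is_cvg_nneseries.
apply: nearW => K; rewrite big_mkord.
have sumA : \sum_(k < K) P (A n k) @[n --> \oo] --> \sum_(k < K) P (A' k).
  by apply: cvg_nnesum => k _ //; apply: nearW => n.
rewrite -(cvg_lim _ sumA)//; apply: lime_le.
  by apply/cvg_ex; eexists; exact: sumA.
apply: nearW => n; apply: le_trans (random_integral_tail_sum _ C0 (g0 n)) _.
rewrite lee_pmul2l ?lte_fin// lee_expeR; apply: ge0_le_integral => //.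
- by move=> e _; rewrite lee_fin subr_ge0 -expR0 ler_expR.
- apply/measurable_EFinP; apply: measurable_funB => //.
  by apply: measurableT_comp => //; exact: measurableT_comp.
- apply/measurable_EFinP; apply: measurable_funB => //.
  by apply: measurableT_comp => //; exact: measurableT_comp.
- by move=> e _; rewrite lee_fin lerB// ler_expR.
Qed.

End poisson_functionals_law.

(** * Logarithmic weights of submultiplicative functions *)

Section log_weight.
Context (R : realType) (G : R -> R) (a c : R).
Hypothesis G_ndecr : nondecreasing_fun G.
Hypothesis G_ge1 : forall x, 1 <= G x.
Hypothesis a_ge1 : 1 <= a.
Hypothesis c_gt0 : 0 < c.
Hypothesis G_submult : forall x y, 0 <= x -> 0 <= y -> G (x + y) <= a * G x * G y.

(** The slope for which exp(log_rate c) = a G(c), the factor by which [G] can grow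
on an interval of length [c]. *)
Definition log_rate : R := ln (a * G c) / c.

(** An additive majorant of ln G, up to a constant. The small jumps may be
infinitely many, so their weights have to be summable whenever the jumps are;
this forces a linear weight for them, while each of the finitely many large jumps
can cost a factor a G(y). *)
Definition log_weight (y : R) : R :=
  if y <= 0 then 0 else if y <= c then log_rate * y else ln (a * G y).

Lemma aG_ge1 x : 1 <= a * G x.
Proof. by rewrite -[leLHS]mulr1 ler_pM. Qed.

Lemma log_rate_ge0 : 0 <= log_rate.
Proof. by rewrite divr_ge0 ?ln_ge0 ?aG_ge1// ltW. Qed.

Lemma log_weight_ge0 y : 0 <= log_weight y.
Proof.
rewrite /log_weight; case: (leP y 0) => // y0; case: ifP => _.
  by rewrite mulr_ge0 ?log_rate_ge0// ltW.
by rewrite ln_ge0 ?aG_ge1.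
Qed.

Lemma log_weight_le0 y : y <= 0 -> log_weight y = 0.
Proof. by rewrite /log_weight => ->. Qed.

Lemma measurable_log_weight : measurable_fun setT log_weight.
Proof.
apply: measurable_fun_ifT => //; first exact: measurable_fun_ler.
apply: measurable_fun_ifT => //; first exact: measurable_fun_ler.
apply: measurableT_comp => //; apply: measurable_funM => //.
exact: nondecreasing_measurable.
Qed.

(** Cover [0, s] by m + 1 <= s / c + 1 intervals of length [c] and use
submultiplicativity on each of them. *)
Lemma submultiplicative_exp_bound s : 0 <= s ->
  G s <= a * G c * expR (log_rate * s).
Proof.
move=> s0.
have aGc : 0 < a * G c by apply: lt_le_trans (aG_ge1 c).
have power m : G (m.+1%:R * c) <= (a * G c) ^+ m.+1.
  elim: m => [|m IH].
    by rewrite mul1r expr1 ler_peMl// (le_trans ler01).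
  rewrite -[in leLHS]natr1 mulrDl mul1r.
  apply: le_trans (G_submult _ _) _; rewrite ?mulr_ge0 ?(ltW c_gt0)//.
  rewrite exprS mulrAC ler_pM2l//.
set m := Num.trunc (s / c).
have sc0 : 0 <= s / c by rewrite divr_ge0// ltW.
have /andP[m1 m2] := truncn_itv sc0.
apply: le_trans (_ : G (m.+1%:R * c) <= _).
  by apply: G_ndecr; rewrite -ler_pdivrMr// ltW.
apply: le_trans (power m) _.
rewrite exprS ler_pM2l// -[in leLHS](@lnK _ (a * G c))// -expRM_natl ler_expR.
rewrite /log_rate mulrAC -mulrA mulrC ler_wpM2l// ln_ge0 ?aG_ge1//.
Qed.

(** By induction on [l]: a large jump is split off by submultiplicativity, while
the small jumps are gathered in [s], so that [submultiplicative_exp_bound] is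
used only once, for their total. *)
Lemma submultiplicative_sum_bound (l : seq R) s : 0 <= s ->
  all (fun y => 0 <= y) l ->
  G (s + \sum_(y <- l) y) <=
  a * G c * expR (log_rate * s) * expR (\sum_(y <- l) log_weight y).
Proof.
elim: l s => [|y l IH] s s0 /=.
  by rewrite !big_nil addr0 expR0 mulr1 => _; exact: submultiplicative_exp_bound.
move=> /andP[y0 l0]; rewrite !big_cons expRD mulrA.
have sl0 : 0 <= s + \sum_(z <- l) z.
  by rewrite addr_ge0// big_seq sumr_ge0// => z /(allP l0).
rewrite {1}/log_weight; case: (leP y 0) => [y0'|y0'].
  by rewrite (_ : y = 0) ?add0r ?expR0 ?mulr1 ?IH//; apply: le_anti; rewrite y0 y0'.
case: (leP y c) => yc.
  by rewrite -(mulrA (a * G c)) -expRD -mulrDr addrA IH// addr_ge0.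
rewrite addrCA; apply: le_trans (G_submult y0 sl0) _.
have aGy : 0 < a * G y by apply: lt_le_trans (aG_ge1 y).
rewrite lnK//.
apply: le_trans (_ : a * G y * (a * G c * expR (log_rate * s) *
    expR (\sum_(j <- l) log_weight j)) <= _).
  by rewrite ler_pM2l// IH.
by rewrite le_eqVlt; apply/orP; left; apply/eqP; ring.
Qed.

Context d (E : measurableType d) (nu : {measure set E -> \bar R}) (t : E -> R).
Hypothesis mt : measurable_fun setT t.
Local Open Scope ereal_scope.

(** Small jumps: exp(x) - 1 <= x exp(x), with x at most log_rate c. Large jumps:
exp of the weight is a G(t), and G(t) is at most 1 plus the number of positive
integers below G(t); integrating the latter count gives the series of the third
hypothesis. *)
Lemma log_weight_integrable :
  \int[nu]_(e in [set e | 0 < t e <= c]%R) (t e)%:E < +oo ->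
  nu [set e | c < t e]%R < +oo ->
  \sum_(n <oo) nu [set e | c < t e /\ n.+1%:R < G (t e)]%R < +oo ->
  \int[nu]_e (expR (log_weight (t e)) - 1)%:E < +oo.
Proof.
move=> small big tails.
pose K := (log_rate * expR (log_rate * c))%R.
have K0 : (0 <= K)%R by rewrite mulr_ge0 ?expR_ge0 ?log_rate_ge0.
have mG : measurable_fun setT (fun e => G (t e)).
  by apply: measurableT_comp => //; exact: nondecreasing_measurable.
pose S := [set e | 0 < t e <= c]%R.
pose B := [set e | c < t e]%R.
pose A n := [set e | c < t e /\ n.+1%:R < G (t e)]%R.
have mS : measurable S.
  rewrite (_ : S = t @^-1` `]0%R, c]); last by apply/seteqP; split=> e; rewrite /S /= in_itv.
  by rewrite -[X in measurable X]setTI; exact: mt.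
have mB : measurable B.
  rewrite (_ : B = t @^-1` `]c, +oo[); last first.
    by apply/seteqP; split=> e; rewrite /B /= in_itv/= andbT.
  by rewrite -[X in measurable X]setTI; exact: mt.
have mA n : measurable (A n).
  rewrite (_ : A n = B `&` (G \o t) @^-1` `]n.+1%:R, +oo[); last first.
    by apply/seteqP; split=> e; rewrite /A /B /= in_itv/= andbT.
  apply: measurableI => //.
  by rewrite -[X in measurable X]setTI; exact: mG.
have mtS : measurable_fun setT (fun e => (t e)%:E * (\1_S e)%:E).
  by apply: emeasurable_funM; apply/measurable_EFinP => //; exact: measurable_indic.
have tS0 e : 0 <= (t e)%:E * (\1_S e)%:E.
  rewrite indicE; case: (boolP (e \in S)); last by rewrite mule0.
  by move=> /set_mem/andP[/ltW t0 _]; rewrite mule1 lee_fin.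
have mind (X : set E) : measurable X -> measurable_fun setT (fun e => (\1_X e)%:E : \bar R).
  by move=> mX; apply/measurable_EFinP; exact: measurable_indic.
have mseries : measurable_fun setT (fun e => \sum_(n <oo) (\1_(A n) e)%:E : \bar R).
  by apply: ge0_emeasurable_sum => // n _; exact: mind.
have series0 e : 0 <= \sum_(n <oo) (\1_(A n) e)%:E :> \bar R by apply: nneseries_ge0.
have a0 : 0 <= a%:E by rewrite lee_fin (le_trans ler01).
have ind0 (X : set E) e : 0 <= (\1_X e)%:E :> \bar R by rewrite lee_fin.
have sum0 e : 0 <= (\1_B e)%:E + \sum_(n <oo) (\1_(A n) e)%:E :> \bar R.
  exact: adde_ge0.
apply: (@le_lt_trans _ _ (\int[nu]_e (K%:E * ((t e)%:E * (\1_S e)%:E) +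
    a%:E * ((\1_B e)%:E + \sum_(n <oo) (\1_(A n) e)%:E)))).
  apply: ge0_le_integral => //.
  - by move=> e _; rewrite lee_fin subr_ge0 -expR0 ler_expR log_weight_ge0.
  - apply/measurable_EFinP; apply: measurable_funB => //.
    apply: measurableT_comp => //; apply: measurableT_comp => //.
    exact: measurable_log_weight.
  - apply: emeasurable_funD; first exact: measurable_funeM.
    by apply: measurable_funeM; apply: emeasurable_funD => //; exact: mind.
  move=> e _.
  have [t0|t0] := leP (t e) 0%R.
    by rewrite log_weight_le0// expR0 subrr adde_ge0// mule_ge0.
  have [tc|tc] := leP (t e) c.
    apply: le_trans (leeDl _ _); last first.
      by rewrite mule_ge0.
    rewrite indicE mem_set ?mule1; last by rewrite /S/= t0.
    have -> : (log_weight (t e) = log_rate * t e)%R.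
      by rewrite /log_weight leNgt t0/= tc.
    rewrite -EFinM lee_fin /K.
    set x := (log_rate * t e)%R.
    have x0 : (0 <= x)%R by rewrite mulr_ge0 ?log_rate_ge0// ltW.
    have : (expR x - 1 <= x * expR x)%R.
      have := expR_ge1Dx (- x).
      rewrite -(ler_pM2r (expR_gt0 x)) -expRD addNr expR0 mulrDl mul1r mulNr.
      by lra.
    move=> /le_trans; apply; rewrite /x mulrAC ler_wpM2r ?(ltW t0)//.
    by rewrite ler_wpM2l ?log_rate_ge0// ler_expR ler_wpM2l ?log_rate_ge0.
  apply: le_trans (leeDr _ _); last by rewrite mule_ge0// lee_fin.
  have aGt : (0 < a * G (t e))%R by apply: lt_le_trans (aG_ge1 _).
  have -> : (log_weight (t e) = ln (a * G (t e)))%R.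
    by rewrite /log_weight leNgt t0/= leNgt tc.
  rewrite lnK//.
  have G0 : (0 <= G (t e))%R by apply: le_trans (G_ge1 _).
  apply: le_trans (_ : a%:E * (G (t e))%:E <= _).
    by rewrite -EFinM lee_fin gerBl.
  rewrite lee_wpmul2l//.
  rewrite indicE mem_set//.
  have /andP[m1 m2] := truncn_itv G0.
  set m := Num.trunc (G (t e)) in m1 m2.
  apply: le_trans (_ : 1 + \sum_(0 <= n < m) (\1_(A n) e)%:E <= _); last first.
    by rewrite leeD2l//; apply: nneseries_lim_ge.
  (* With m the integer part of [G (t e)], the integers 1, ..., m - 1 lie strictly
     below [G (t e)], and so does m unless [G (t e) = m]. *)
  have mpos : (0 < m)%N by rewrite truncn_gt0.
  rewrite -(prednK mpos) in m1 m2 *.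
  rewrite big_nat_recr//= (eq_big_nat _ _ (F2 := fun=> 1%:E)); last first.
    move=> n /andP[_ nm]; rewrite indicE mem_set//; split=> //.
    by apply: lt_le_trans m1; rewrite ltr_nat.
  rewrite sumEFin sumr_const_nat subn0 addeA -EFinD.
  have [Gm|Gm] := leP (G (t e)) m.-1.+1%:R.
    by rewrite lee_fin (le_trans Gm)// -natr1 addrC lerDl.
  rewrite indicE mem_set// lee_fin ltW// (lt_le_trans m2)//.
  by rewrite -!natr1; lra.
rewrite ge0_integralD//; last 4 first.
- by move=> e _; rewrite mule_ge0// lee_fin.
- exact: measurable_funeM.
- by move=> e _; rewrite mule_ge0 ?adde_ge0// lee_fin (le_trans _ a_ge1).
- by apply: measurable_funeM; apply: emeasurable_funD => //; exact: mind.
rewrite !ge0_integralZl//; last first.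
- by apply: emeasurable_funD => //; exact: mind.
rewrite lte_add_pinfty// lte_mul_pinfty//.
  move: small; rewrite -/S integral_mkcond; congr (_ < _); apply: eq_integral => e _.
  by rewrite /patch indicE; case: ifP => _; rewrite ?mule1 ?mule0.
rewrite ge0_integralD//; last by exact: mind.
rewrite integral_nneseries//; last by move=> n; exact: mind.
rewrite lte_add_pinfty//; first by rewrite integral_indic ?setIT.
by under eq_eseriesr do rewrite integral_indic ?setIT//.
Qed.

End log_weight.

(** * The inverse function *)

Section inverse.
Context (R : realType) (f : R -> R).
Hypothesis f_incr : {in `[1, +oo[ &, {homo f : s t / s < t}}.
Hypothesis f_derivable : derivable_cy f 1.
Hypothesis f_cvgy : f t @[t --> +oo] --> +oo.

(** Intermediate value theorem. Continuity at 1 comes from the one-sided difference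
quotient, which converges, multiplied by its increment. *)
Lemma derivable_cy_surj : set_surj `[1, +oo[ `[f 1, +oo[ f.
Proof.
move=> y /=; rewrite in_itv/= andbT le_eqVlt => /orP[/eqP <-|fy].
  by exists 1 => //=; rewrite in_itv/= lexx.
have [b b1 yb] : exists2 b, 1 < b & y <= f b.
  by apply: pinfty_ex_gt; [rewrite num_real|move/cvgryPge : f_cvgy; exact].
have derivable_continuous t : 1 < t -> {for t, continuous f}.
  move=> t1; apply: differentiable_continuous; apply/derivable1_diffP.
  by apply: (f_derivable.1); rewrite in_itv/= t1.
have fc : {within `[1, b], continuous f}.
  apply/continuous_within_itvP => //; split.
  - by move=> t; rewrite in_itv/= => /andP[t1 _]; exact: derivable_continuous.
  - case: f_derivable => _ /cvg_ex[/= l quotient].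
    have incr0 : h * (h^-1 *: (f (h + 1) - f 1)) @[h --> 0^'+] --> 0.
      rewrite -[X in _ --> X](mul0r l); apply: cvgM quotient.
      exact: cvg_at_right_filter.
    apply/cvgrPdist_lt => e e0; apply/nbhs_right0P.
    move/cvgrPdist_lt : incr0 => /(_ e e0); apply: filterS2 (nbhs_right_gt 0).
    move=> h h0; rewrite sub0r normrN mulrA mulfV ?gt_eqF// mul1r.
    by rewrite (distrC (f 1)) (addrC 1 h).
  - by apply: cvg_at_left_filter; exact: derivable_continuous.
have [|t] := @IVT R f 1 b y (ltW b1) fc.
  by rewrite ge_min le_max (ltW fy) yb orbT.
by rewrite in_itv/= => /andP[t1 _] fty; exists t => //=; rewrite in_itv/= t1.
Qed.


Local Notation g := ('pinv_(fun=> 1) `[1, +oo[ f).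

Lemma pinv_ge1 y : f 1 <= y -> 1 <= g y.
Proof.
move=> fy; have := surjpinv_image_sub (dflt := fun=> 1) derivable_cy_surj.
move=> /(_ (g y)); rewrite /= in_itv/= andbT; apply.
by exists y => //=; rewrite in_itv/= fy.
Qed.

Lemma pinv_inverse y : f 1 <= y -> f (g y) = y.
Proof.
move=> fy; apply: pinvK; apply/mem_set; apply: derivable_cy_surj.
by rewrite /= in_itv/= fy.
Qed.

Lemma incr_lt s t : 1 <= s -> 1 <= t -> (f s < f t) = (s < t).
Proof.
move=> s1 t1; apply/idP/idP => [|st]; last by apply: f_incr; rewrite ?in_itv/= ?s1 ?t1.
apply: contraTT; rewrite -!leNgt le_eqVlt => /orP[/eqP->//|ts].
by apply/ltW/f_incr; rewrite ?in_itv/= ?s1 ?t1.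
Qed.

Variable L : R.
Hypothesis L_gt0 : 0 < L.
Hypothesis f1_gt0 : 0 < f 1.

(** The inverse of L f. Truncating the argument at [f 1] extends it to the whole
line and preserves both monotonicity and submultiplicativity. *)
Definition scaled_inverse (y : R) : R := g (Num.max (y / L) (f 1)).

Let f1_max y : f 1 <= Num.max (y / L) (f 1).
Proof. by rewrite le_max lexx orbT. Qed.

Lemma scaled_inverse_ge1 y : 1 <= scaled_inverse y.
Proof. exact: pinv_ge1. Qed.

Lemma scaled_inverse_nondecreasing : nondecreasing_fun scaled_inverse.
Proof.
move=> x y xy; rewrite leNgt; apply/negP.
rewrite -incr_lt ?scaled_inverse_ge1// !pinv_inverse// ltNge => /negP; apply.
by rewrite ge_max !le_max lexx orbT ler_pM2r ?invr_gt0// xy.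
Qed.

Lemma lt_scaled_inverse t y : 1 <= t -> (t < scaled_inverse y) = (L * f t < y).
Proof.
move=> t1; rewrite -incr_lt ?scaled_inverse_ge1// pinv_inverse//.
rewrite lt_max [X in _ || X]ltNge.
have -> /= : f 1 <= f t.
  by move: t1; rewrite le_eqVlt => /orP[/eqP->//|t1]; rewrite ltW// incr_lt// ltW.
by rewrite orbF ltr_pdivlMr// mulrC.
Qed.

Lemma scaled_inverse_submultiplicative :
  submultiplicative_on `[f 1, +oo[ g ->
  exists2 a, 1 <= a & forall x y, 0 <= x -> 0 <= y ->
    scaled_inverse (x + y) <= a * scaled_inverse x * scaled_inverse y.
Proof.
move=> [a a0 ga]; exists (Num.max a 1); first by rewrite le_max lexx orbT.
move=> x y x0 y0; set x' := Num.max (x / L) (f 1); set y' := Num.max (y / L) (f 1).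
have gE : g (x' + y') <= a * g x' * g y'.
  by apply: ga; rewrite /= in_itv/= andbT f1_max.
have g0 z : 0 <= g (Num.max (z / L) (f 1)).
  by rewrite (le_trans ler01)// pinv_ge1.
apply: (@le_trans _ _ (g (x' + y'))).
  have f1xy : f 1 <= x' + y' 
    by rewrite -[leLHS]addr0; apply: lerD (f1_max x) (le_trans (ltW f1_gt0) (f1_max y)).
  rewrite leNgt; apply/negP; rewrite -incr_lt ?pinv_ge1// !pinv_inverse//.
  rewrite ltNge ge_max f1xy andbT mulrDl => /negP; apply.
  by rewrite lerD// le_max lexx.
apply: le_trans gE _; rewrite !ler_wpM2r// ?g0// le_max lexx//.
Qed.

End inverse.

(** * Eventual bounds for Poisson sums *)

Section point_measures.
Context d (E : measurableType d) (R : realType) (m : {measure set E -> \bar R}).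
Variables (I : set nat) (p : nat -> E).
Local Open Scope ereal_scope.
Hypothesis mp : forall B, measurable B -> m B = \esum_(k in I) \d_(p k) B.

Lemma esum_nneseries (a : nat -> \bar R) : (forall k, I k -> 0 <= a k) ->
  \esum_(k in I) a k = \sum_(k <oo) (if k \in I then a k else 0).
Proof.
move=> a0; rewrite esum_mkcond nneseries_esumT// => k.
by case: ifPn => // /set_mem; exact: a0.
Qed.

(** A measure that is a sum of point masses on measurable sets integrates
functions by summing over the points. *)
Lemma integral_points (phi : E -> \bar R) :
  measurable_fun setT phi -> (forall e, 0 <= phi e) ->
  \int[m]_e phi e = \esum_(k in I) phi (p k).
Proof.
move=> mphi phi0.
pose m_ k : {measure set E -> \bar R} :=
  if k \in I then [the measure _ _ of \d_(p k)] else [the measure _ _ of mzero].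
rewrite (@eq_measure_integral _ _ _ _ (mseries m_ 0)); last first.
  move=> B mB _; rewrite mp// esum_nneseries//; apply: eq_eseriesr => k _.
  by rewrite /m_; case: ifP.
rewrite ge0_integral_measure_series// esum_nneseries//; apply: eq_eseriesr => k _.
rewrite /m_; case: ifP => _; last by rewrite integral_measure_zero.
by rewrite integral_dirac// diracE in_setT mul1e.
Qed.

End point_measures.

Section eventual_bound.
Context d (Omega : measurableType d) (R : realType) (P : probability Omega R).
Context d' (E : measurableType d') (nu : {measure set E -> \bar R})
  (mu : Omega -> {measure set E -> \bar R}).
Hypothesis prm : poisson_random_measure P nu mu.
Variables (A : nat -> set Omega) (p : nat -> Omega -> E).
Hypothesis points : forall w B, measurable B ->
  mu w B = (\esum_(k in [set k | A k w]) \d_(p k w) B)%E.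
Variables (f : R -> R) (L : R).
Hypothesis f_incr : {in `[1, +oo[ &, {homo f : s t / s < t}}.
Hypothesis f_derivable : derivable_cy f 1.
Hypothesis f_cvgy : f t @[t --> +oo] --> +oo.
Hypothesis f1_gt0 : 0 < f 1.
Hypothesis g_submult : submultiplicative_on `[f 1, +oo[ ('pinv_(fun=> 1) `[1, +oo[ f).
Hypothesis L_gt0 : 0 < L.
Variable T : nat -> E -> R.
Hypothesis mT : forall k, measurable_fun setT (T k).
Hypothesis T_ge0 : forall k j w, A j w -> 0 <= T k (p j w).
Hypothesis lawT : forall k (B : set R), measurable B -> B `<=` `]0, +oo[ ->
  nu (T k @^-1` B) = nu (T 0%N @^-1` B).
Local Open Scope ereal_scope.
Hypothesis small_jumps : forall c : R, (0 < c)%R ->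
  \int[nu]_(e in [set e | 0 < T 0%N e <= c]%R) (T 0%N e)%:E < +oo.
Hypothesis big_jumps : \sum_(n <oo) nu [set e | L * f n.+2%:R < T 0%N e]%R < +oo.

(** Borel-Cantelli for the events {ln((k + 1) / C) < Phi_k}, where Phi_k is the
sum of the weights of the terms of the k-th sum. If the k-th sum exceeds
L f(k + 1), so does one of its partial sums, and G of that partial sum is larger
than k + 1 and at most C exp(Phi_k). The index k stands for the time k + 1, as
[f] is given on [1, oo). *)
Lemma poisson_sums_eventually_le : {ae P, forall w, exists K, forall k, (K <= k)%N ->
  \esum_(j in [set j | A j w]) (T k (p j w))%:E <= (L * f k.+1%:R)%:E}.
Proof.
have [a a1 G_submult] := scaled_inverse_submultiplicative f_incr f_derivable f_cvgy L f1_gt0 g_submult.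
set G := scaled_inverse f L in G_submult.
have G_ndecr : nondecreasing_fun G by exact: scaled_inverse_nondecreasing.
have G_ge1 x : (1 <= G x)%R by exact: scaled_inverse_ge1.
have ltG t y : (1 <= t -> (t < G y) = (L * f t < y))%R by exact: lt_scaled_inverse.
(* Jumps count as large above L f(2): the tail at this level is the first term of
   the series in [big_jumps], hence finite. *)
pose c := (L * f 2)%R.
have nat_ge1 n : (1 <= n.+1%:R :> R)%R by rewrite ler1n.
have c0 : (0 < c)%R.
  rewrite mulr_gt0// (lt_trans f1_gt0)// f_incr ?ltr1n// in_itv/= ?lexx//.
  by rewrite (nat_ge1 1%N).
pose u := log_weight G a c.
have mu_ : measurable_fun setT u by exact: measurable_log_weight.
have u0 y : (0 <= u y)%R by exact: log_weight_ge0.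
have u_le0 y : (y <= 0)%R -> u y = 0%R by exact: log_weight_le0.
pose C := (a * G c)%R.
have C0 : (0 < C)%R by rewrite (lt_le_trans ltr01)// aG_ge1.
have mlt x : measurable [set e | x < T 0%N e]%R.
  rewrite (_ : [set e | _] = T 0%N @^-1` `]x, +oo[); last first.
    by apply/seteqP; split=> e /=; rewrite in_itv/= andbT.
  by rewrite -[X in measurable X]setTI; exact: mT.
have finite_integral : \int[nu]_e (expR (u (T 0%N e)) - 1)%:E < +oo.
  apply: log_weight_integrable => //; first exact: small_jumps.
    apply: le_lt_trans big_jumps; rewrite nneseries_recl// /c.
    by apply: leeDl; exact: nneseries_ge0.
  have mB n : measurable [set e | c < T 0%N e /\ n.+1%:R < G (T 0%N e)]%R.
    rewrite (_ : [set e | _] = [set e | c < T 0%N e]%R `&` [set e | L * f n.+1%:R < T 0%N e]%R).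
      exact: measurableI.
    by apply/seteqP; split=> e [/= ? h]; split => //; move: h; rewrite ltG.
  rewrite nneseries_recl//; apply: lte_add_pinfty.
    apply: le_lt_trans big_jumps; rewrite nneseries_recl//.
    apply: le_trans (leeDl _ _); last exact: nneseries_ge0.
    by apply: le_measure; [exact/mem_set/(mB 0%N)|exact/mem_set/mlt|move=> e []].
  rewrite -(nneseries_addn 1)//.
  apply: le_lt_trans big_jumps; apply: lee_nneseries => // n _.
  rewrite addn1; apply: le_measure; [exact/mem_set/mB|exact/mem_set/mlt|].
  by move=> e [/= _]; rewrite ltG.
pose X k w := \int[mu w]_e (u (T k e))%:E.
pose D k := [set w | (ln (k.+1%:R / C))%:E < X k w].
have muT k : measurable_fun setT (fun e => (u (T k e))%:E).
  by apply/measurable_EFinP; exact: measurableT_comp.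
have mD k : measurable (D k).
  rewrite -[X in measurable X]setTI; apply: emeasurable_fun_o_infty => //.
  by apply: (measurable_random_integral prm) => // e; rewrite lee_fin.
have PD : P (lim_sup_set D) = 0.
  apply: lim_sup_set_cvg0 => //.
  apply: le_lt_trans (random_integral_tail_series prm mT lawT mu_ u0 u_le0 C0) _.
  move: finite_integral; case: (\int[nu]_e _) => [r _| |_] //=; first exact: ltry.
  by rewrite mule0.
have mlimsup : measurable (lim_sup_set D).
  apply: bigcapT_measurable => n; exact: bigcup_measurable.
exists (lim_sup_set D); split => // w /= nbound; apply: contrapT => wD; apply: nbound.
have /existsNP[K KD] : ~ forall n, (\bigcup_(j in [set j | n <= j]%N) D j) w.
  by move=> h; apply: wD => n _; exact: h.
exists K => k Kk; rewrite leNgt; apply/negP => Xk; apply: KD; exists k => //.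
rewrite esum_nneseries in Xk; last by move=> j Aj; rewrite lee_fin T_ge0.
pose y j := (if j \in [set j | A j w] then T k (p j w) else 0)%R.
have y0 j : (0 <= y j)%R by rewrite /y; case: ifPn => // /set_mem; exact: T_ge0.
have yE j : (if j \in [set j | A j w] then (T k (p j w))%:E else 0) = (y j)%:E.
  by rewrite /y; case: ifP.
have [N yN] : exists N, (L * f k.+1%:R < \sum_(0 <= j < N) y j)%R.
  apply: contrapT => /forallNP ynN; move: Xk; apply/negP; rewrite -leNgt.
  apply: lime_le; first by apply: is_cvg_nneseries => j _ _; rewrite yE lee_fin.
  apply: nearW => N; under eq_bigr do rewrite yE.
  by rewrite sumEFin lee_fin leNgt; apply/negP/ynN.
have bound : (G (\sum_(0 <= j < N) y j) <= C * expR (\sum_(0 <= j < N) u (y j)))%R.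
  have := submultiplicative_sum_bound G_ndecr G_ge1 a1 c0 G_submult
    (l := [seq y j | j <- index_iota 0 N]) (lexx 0).
  rewrite add0r mulr0 expR0 mulr1 !big_map; apply.
  by apply/allP => _ /mapP[j _ ->]; exact: y0.
have sum_le : (\sum_(0 <= j < N) u (y j))%:E <= X k w.
  rewrite /X (integral_points (points w))//; last by move=> e; rewrite lee_fin.
  rewrite esum_nneseries; last by move=> j _; rewrite lee_fin.
  rewrite -sumEFin; apply: le_trans (nneseries_lim_ge N _); last first.
    by move=> j _ _; case: ifP; rewrite ?lee_fin.
  apply: lee_sum => j _; rewrite /y; case: ifP => // _.
  by rewrite u_le0.
apply: lt_le_trans sum_le; rewrite lte_fin -ltr_expR lnK ?posrE ?divr_gt0//.
rewrite ltr_pdivrMr// mulrC; apply: lt_le_trans bound.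
by rewrite ltG.
Qed.

End eventual_bound.

(** * Change of measure and of variable *)

Section packing.
Context d (T : measurableType d) (R : realType).
Local Open Scope ereal_scope.

(** Tonelli's theorem needs the finiteness of the measures in their type. *)
Lemma finite_measure_of (m : {measure set T -> \bar R}) : m setT < +oo ->
  exists m' : {finite_measure set T -> \bar R}, m = m' :> (set T -> \bar R).
Proof.
move=> /lty_fin_num_fun mfin.
have m_sigma : sigma_finite setT m.
  by apply: fin_num_fun_sigma_finite mfin; rewrite measure0.
pose H1 := isFinite.Build _ _ _ _ mfin.
pose H2 := isSFinite.Build _ _ _ _ (sfinite_measure_sigma_finite m_sigma).
pose H3 := isSigmaFinite.Build _ _ _ _ m_sigma.
by exists (HB.pack_for (FiniteMeasure.type T R) (Measure.sort m) H1 H2 H3).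
Qed.

Lemma sigma_finite_measure_of (m : {measure set T -> \bar R}) :
  sigma_finite setT m ->
  exists m' : {sigma_finite_measure set T -> \bar R}, m = m' :> (set T -> \bar R).
Proof.
move=> m_sigma.
pose H2 := isSFinite.Build _ _ _ _ (sfinite_measure_sigma_finite m_sigma).
pose H3 := isSigmaFinite.Build _ _ _ _ m_sigma.
by exists (HB.pack_for (SigmaFiniteMeasure.type T R) (Measure.sort m) H2 H3).
Qed.

End packing.

Section affine_change_of_variable.
Context (R : realType).
Local Notation leb := (@lebesgue_measure R).
Local Open Scope ereal_scope.

(** The map s -> c (b - s) carries Lebesgue measure to its multiple by 1 / c. *)
Lemma lebesgue_integral_affine (V : R -> \bar R) (c b : R) : (0 < c)%R ->
  measurable_fun setT V -> (forall y, 0 <= V y) ->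
  \int[leb]_s V (c * (b - s))%R = c^-1%:E * \int[leb]_u V u.
Proof.
move=> c0 mV V0.
have ci0 : (0 <= c^-1)%R by rewrite invr_ge0 ltW.
pose psi : measurableTypeR R -> measurableTypeR R := fun u => (b - c^-1 * u)%R.
have mpsi : measurable_fun setT psi.
  by apply: measurable_funB => //; exact: measurable_funM.
have lebE (B : set (measurableTypeR R)) : measurable B ->
    pushforward (mscale (NngNum ci0) leb) psi B = leb B.
  move=> mB; apply/esym/lebesgue_measure_unique => //= _ [[x y]] _ <-.
  rewrite /pushforward /mscale/=.
  have -> : psi @^-1` `]x, y] = `[c * (b - y), c * (b - x)[%classic%R.
    apply/seteqP; split=> u; have [v ->] : exists v, u = (c * v)%R;
      do ?[by exists (c^-1 * u)%R; rewrite mulVKf ?gt_eqF];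
      rewrite /psi /= !in_itv/= mulKf ?gt_eqF// ler_pM2l// ltr_pM2l// => /andP[h1 h2];
      by apply/andP; split; lra.
  rewrite !lebesgue_measure_itv/= !lte_fin ltr_pM2l// ltrD2l ltrN2.
  case: ifP => _; last by rewrite mule0.
  by rewrite -!EFinD -EFinM; congr EFin; field; rewrite gt_eqF.
transitivity (\int[pushforward (mscale (NngNum ci0) leb) psi]_s V (c * (b - s))%R).
  by apply: eq_measure_integral => B mB _; exact/esym/lebE.
have mVc : measurable_fun setT (fun s : measurableTypeR R => V (c * (b - s))%R).
  apply: measurableT_comp => //; apply: measurable_funM => //.
  exact: measurable_funB.
rewrite ge0_integral_pushforward//.
rewrite preimage_setT ge0_integral_mscale//; last 2 first.
- exact: (measurableT_comp mVc mpsi).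
- by move=> u _; exact: V0.
congr (_ * _); apply: eq_integral => u _; rewrite /= /psi; congr V.
by field; rewrite gt_eqF.
Qed.

End affine_change_of_variable.

(** * Jumps of the supOU process *)

Section supou_jumps.
Context (R : realType).
Local Notation MR := (measurableTypeR R).
Local Notation leb := (@lebesgue_measure R).

(** The contribution of the point (x, s, z) to X(t). *)
Definition decayed_jump (t : R) (e : MR * MR * MR) : R :=
  if e.1.2 <= t then expR (- e.1.1 * (t - e.1.2)) * e.2 else 0.

(** An upper bound, uniform on [t, t + 1), for the contribution to X of a point
that arrives after time t. *)
Definition window_jump (t : R) (e : MR * MR * MR) : R :=
  if t < e.1.2 <= t + 1 then e.2 else 0.

Let mx : measurable_fun setT (fun e : MR * MR * MR => e.1.1 : R).
Proof. by apply: measurableT_comp => //; exact: measurable_fst. Qed.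

Let ms : measurable_fun setT (fun e : MR * MR * MR => e.1.2 : R).
Proof. by apply: (measurableT_comp measurable_snd); exact: measurable_fst. Qed.

Let mz : measurable_fun setT (fun e : MR * MR * MR => e.2 : R).
Proof. exact: measurable_snd. Qed.

Lemma measurable_decayed_jump t : measurable_fun setT (decayed_jump t).
Proof.
apply: measurable_fun_ifT => //; first exact: measurable_fun_ler.
apply: measurable_funM => //; apply: measurableT_comp => //.
apply: measurable_funM; first exact: measurableT_comp.
exact: measurable_funB.
Qed.

Lemma measurable_window_jump t : measurable_fun setT (window_jump t).
Proof.
apply: measurable_fun_ifT => //; apply: measurable_and.
  exact: measurable_fun_ltr.
exact: measurable_fun_ler.
Qed.

Variables (pim : {finite_measure set MR -> \bar R})
  (lam : {sigma_finite_measure set MR -> \bar R}).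
Hypothesis pim_pos : on_positive_half_line pim.
Local Open Scope ereal_scope.

(** The product [pim \x leb] with its sigma-finiteness in the type. *)
Variable pim_leb : {sigma_finite_measure set (MR * MR)%type -> \bar R}.
Hypothesis pim_lebE : pim_leb = (pim \x leb) :> (set (MR * MR)%type -> \bar R).

Let nu : {measure set (MR * MR * MR)%type -> \bar R} := pim_leb \x lam.

Lemma integral_intensity (F : MR * MR * MR -> \bar R) :
  measurable_fun setT F -> (forall e, 0 <= F e) ->
  \int[nu]_e F e = \int[pim]_x \int[leb]_s \int[lam]_z F (x, s, z).
Proof.
move=> mF F0.
have mF1 := measurable_fun_fubini_tonelli_F (m2 := lam) F mF F0.
have F10 xs : 0 <= fubini_F lam F xs by exact: integral_ge0.
transitivity (\int[pim_leb]_xs fubini_F lam F xs).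
  exact: (@fubini_tonelli1 _ _ _ _ _ pim_leb lam F mF F0).
transitivity (\int[pim \x leb]_xs fubini_F lam F xs); first by rewrite -pim_lebE.
exact: (@fubini_tonelli1 _ _ _ _ _ pim leb (fubini_F lam F) mF1 F10).
Qed.

Lemma measurable_intensity_section (F : MR * MR * MR -> \bar R) :
  measurable_fun setT F -> (forall e, 0 <= F e) ->
  measurable_fun setT (fun x : MR => \int[leb]_s \int[lam]_z F (x, s, z)).
Proof.
move=> mF F0.
have mF1 := measurable_fun_fubini_tonelli_F (m2 := lam) F mF F0.
have F10 xs : 0 <= fubini_F lam F xs by exact: integral_ge0.
exact: (measurable_fun_fubini_tonelli_F (m2 := leb) (fubini_F lam F) mF1 F10).
Qed.

Lemma measurable_exp_scale (H : R -> \bar R) : measurable_fun setT H ->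
  (forall y, 0 <= H y) ->
  measurable_fun setT (fun u : MR => \int[lam]_z H (expR (- u) * z)%R).
Proof.
move=> mH H0.
have mF : measurable_fun setT (fun uz : MR * MR => H (expR (- uz.1) * uz.2)%R).
  apply: measurableT_comp => //; apply: measurable_funM => //.
  by apply: measurableT_comp => //; apply: measurableT_comp => //.
exact: (measurable_fun_fubini_tonelli_F (m2 := lam) _ mF).
Qed.

(** For fixed x, the substitution u = x (t - s) turns ds into du / x and the decay
factor into exp(-u); integrating 1 / x against pi gives the moment of order
-1. The time [t] disappears, which is the stationarity of X. *)
Lemma integral_decayed_jump (H : R -> \bar R) t :
  measurable_fun setT H -> (forall y, 0 <= H y) -> H 0%R = 0 ->
  \int[nu]_e H (decayed_jump t e) =
  moment (-1)%R pim * \int[leb]_(u in `[0%R, +oo[) \int[lam]_z H (expR (- u) * z)%R.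
Proof.
move=> mH H0 H00.
pose W u := \int[lam]_z H (expR (- u) * z)%R.
have mW : measurable_fun setT W by exact: measurable_exp_scale.
have W0 u : 0 <= W u by exact: integral_ge0.
have mI : measurable (`[0%R, +oo[ : set R) by exact: measurable_itv.
pose V := W \_ `[0%R, +oo[.
have mV : measurable_fun setT V.
  by apply/(measurable_restrictT _ mI); exact: measurable_funTS.
have V0 u : 0 <= V u by rewrite /V /patch; case: ifP.
have VI : \int[leb]_(u in `[0%R, +oo[) W u = \int[leb]_u V u.
  by rewrite integral_mkcond.
rewrite integral_intensity//; last first.
  by apply: measurableT_comp => //; exact: measurable_decayed_jump.
rewrite (@ge0_negligible_integral _ _ _ pim setT (~` `]0%R, +oo[))//; last 3 first.
- by apply: measurableC; exact: measurable_itv.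
- apply: (@measurable_intensity_section (fun e => H (decayed_jump t e))) => //.
  by apply: measurableT_comp => //; exact: measurable_decayed_jump.
- by move=> x _; apply: integral_ge0 => s _; exact: integral_ge0.
rewrite setTD setCK.
transitivity (\int[pim]_(x in `]0%R, +oo[) ((x `^ (-1))%:E * \int[leb]_u V u)).
  apply: eq_integral => x /set_mem; rewrite /= in_itv/= andbT => x0.
  rewrite (powR_inv1 (ltW x0)).
  apply: etrans (lebesgue_integral_affine t x0 mV V0).
  apply: eq_integral => s _.
  rewrite /V /patch mem_setE in_itv/= andbT pmulr_rge0// subr_ge0 /W /decayed_jump/=.
  case: ifP => _; first by apply: eq_integral => z _; rewrite mulNr.
  by rewrite integral0_eq.
rewrite VI /moment ge0_integralZr//.
- by apply/measurable_EFinP; apply: measurable_funTS; exact: measurable_powR.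
- by move=> x _; rewrite lee_fin powR_ge0.
- exact: integral_ge0.
Qed.


Lemma decayed_jump_law t (B : set R) : measurable B -> B `<=` `]0%R, +oo[ ->
  nu (decayed_jump t @^-1` B) = supou_marginal_levy_measure pim lam B.
Proof.
move=> mB B0.
have mT : measurable (decayed_jump t @^-1` B).
  by rewrite -[X in measurable X]setTI; exact: measurable_decayed_jump.
have NB0 : ~ B 0%R by move=> /B0; rewrite /= in_itv/= ltxx.
transitivity (\int[nu]_e (\1_(decayed_jump t @^-1` B) e)%:E).
  by rewrite (integral_indic nu measurableT)// setIT.
rewrite (integral_decayed_jump t (H := EFin \o \1_B))//; last 3 first.
- by apply/measurable_EFinP; exact: measurable_indic.
- by move=> y; rewrite lee_fin.
- by rewrite /= indicE memNset.
rewrite /supou_marginal_levy_measure; congr (_ * _).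
rewrite -integral_itv_obnd_cbnd; last first.
  apply: measurable_funTS; apply: (@measurable_exp_scale (EFin \o \1_B)).
    by apply/measurable_EFinP; exact: measurable_indic.
  by move=> y; rewrite lee_fin.
rewrite integral_mkcond /product_measure1; apply: eq_integral => u _.
rewrite /patch /=; case: ifPn => [|] u0; last first.
  rewrite (_ : xsection _ _ = set0) ?measure0//.
  apply/seteqP; split => // z /set_mem /= -[u1 _ _].
  by move/negP : u0; apply; rewrite mem_setE in_itv/= u1.
rewrite -[X in _ = lam X]setIT -(integral_indic lam measurableT); last first.
  apply: measurable_xsection.
  rewrite (_ : [set uz | _] = (fst @^-1` `]0%R, +oo[) `&` ((snd @^-1` `]0%R, +oo[) `&`
      ((fun uz : MR * MR => (expR (- uz.1) * uz.2)%R) @^-1` B))); last first.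
    by apply/seteqP; split=> -[v z] /=; rewrite !in_itv/= !andbT => -[? [? ?]] || move=> [? ? ?].
  apply: measurableI; last apply: measurableI.
  - by rewrite -[X in measurable X]setTI; exact: measurable_fst.
  - by rewrite -[X in measurable X]setTI; exact: measurable_snd.
  - rewrite -[X in measurable X]setTI.
    have mprod : measurable_fun setT (fun uz : MR * MR => (expR (- uz.1) * uz.2)%R).
      apply: measurable_funM => //; apply: measurableT_comp => //.
      exact: measurableT_comp.
    exact: mprod.
apply: eq_integral => z _ /=; congr EFin; rewrite !indicE; congr (_ : bool)%:R.
rewrite mem_xsection; apply/idP/idP => [/set_mem Bz|/set_mem[_ _ Bz]]; last exact/mem_set.
  apply/mem_set; split=> //=.
    by move: u0; rewrite mem_setE in_itv/= andbT.
  by have := B0 _ Bz; rewrite /= in_itv/= andbT pmulr_rgt0// expR_gt0.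
Qed.

Let mind (X : set MR) :
  measurable X -> measurable_fun setT (fun e => (\1_X e)%:E : \bar R).
Proof. by move=> mX; apply/measurable_EFinP; exact: measurable_indic. Qed.

Hypothesis lam_small : \int[lam]_(z in `]0%R, 1%R]) z%:E < +oo.
Hypothesis lam_tail : forall r, (0 < r)%R -> lam `]r, +oo[%classic < +oo.

(** Near 0 the function is compared with z, which is integrable there, and away
from 0 with the constant [c], as the tails are finite. *)
Lemma integral_truncated_lty (h : R -> \bar R) (c : R) : (0 < c)%R ->
  measurable_fun setT h -> (forall z, 0 <= h z) ->
  (forall z, (z <= 0)%R -> h z = 0) ->
  (forall z, (0 < z)%R -> h z <= z%:E /\ h z <= c%:E) ->
  \int[lam]_z h z < +oo.
Proof.
move=> c0 mh h_ge0 h_le0 h_le.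
have small0 z : 0 <= z%:E * (\1_(`]0%R, 1%R]) z)%:E :> \bar R.
  rewrite indicE; case: (boolP (z \in _)) => [|_]; last by rewrite mule0.
  by move/set_mem; rewrite /= in_itv/= mule1 lee_fin => /andP[/ltW].
apply: (@le_lt_trans _ _ (\int[lam]_z (z%:E * (\1_(`]0%R, 1%R]) z)%:E +
    c%:E * (\1_(`]1%R, +oo[) z)%:E))).
  apply: ge0_le_integral => //.
  - apply: emeasurable_funD; first by apply: emeasurable_funM => //; exact: mind.
    by apply: measurable_funeM; exact: mind.
  move=> z _; have [z0|z0] := leP z 0%R.
    by rewrite h_le0// adde_ge0// mule_ge0// lee_fin ltW.
  have [hz hc] := h_le z z0; have [z1|z1] := leP z 1%R.
    rewrite indicE mem_set ?mule1; last by rewrite /= in_itv/= z0.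
    by apply: le_trans hz (leeDl _ _); rewrite mule_ge0// lee_fin ltW.
  have -> : (\1_(`]1%R, +oo[ : set R) z = 1 :> R)%R.
    by rewrite indicE mem_set//= in_itv/= z1.
  rewrite mule1.
  exact: le_trans hc (leeDr _ _).
rewrite ge0_integralD//; last 3 first.
- by apply: emeasurable_funM => //; exact: mind.
- by move=> z _; rewrite mule_ge0// lee_fin ltW.
- by apply: measurable_funeM; exact: mind.
apply: lte_add_pinfty.
  rewrite (_ : \int[lam]_z _ = \int[lam]_(z in `]0%R, 1%R]) z%:E)//.
  rewrite [RHS]integral_mkcond; apply: eq_integral => z _.
  by rewrite /patch indicE; case: ifP => _; rewrite ?mule1 ?mule0.
rewrite ge0_integralZl//; last 2 first.
- exact: mind.
- by rewrite lee_fin ltW.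
by rewrite integral_indic// setIT lte_mul_pinfty// ?lee_fin ?ltW// lam_tail.
Qed.

Lemma integral_exp_tail (a : R) :
  \int[leb]_(u in `[a, +oo[) (expR (- u))%:E = (expR (- a))%:E.
Proof.
have dF (x : R) : is_derive x 1%R (fun u => - expR (- u))%R (expR (- x)).
  have := @is_derive1_comp _ expR (fun u => - u)%R x _ _ (is_derive_expR _) (is_deriveNid _ _).
  move=> /is_deriveN; rewrite mulrN1 opprK; exact.
have cE : continuous (fun u : R => expR (- u)).
  by move=> x; apply: continuous_comp; [exact: opp_continuous|exact: continuous_expR].
rewrite (@ge0_continuous_FTC2y _ (fun u => expR (- u)) (fun u => - expR (- u))%R a 0%R).
- by rewrite sub0e -EFinN opprK.
- by move=> x _; exact: expR_ge0.
- exact: continuous_subspaceT.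
- by rewrite -[X in _ --> X]oppr0; apply: cvgN; exact: cvgr_expR.
- by move=> x _; apply: ex_derive.
- by apply: cvg_at_right_filter; apply: cvgN; exact: cE.
- by move=> x _; rewrite derive1E derive_val.
Qed.

Let truncated (c y : R) : \bar R := (if (0 < y <= c)%R then y else 0%R)%:E.

Let measurable_truncated c : measurable_fun setT (truncated c).
Proof.
apply/measurable_EFinP; apply: measurable_fun_ifT => //; apply: measurable_and.
  exact: measurable_fun_ltr.
exact: measurable_fun_ler.
Qed.

Let truncated_ge0 c y : 0 <= truncated c y.
Proof. by rewrite lee_fin; case: ifP => // /andP[/ltW]. Qed.

Let truncated0 c : truncated c 0%R = 0.
Proof. by rewrite /truncated ltxx. Qed.

Let integral_truncated (t : MR * MR * MR -> R) c :
  \int[nu]_(e in [set e | 0 < t e <= c]%R) (t e)%:E = \int[nu]_e truncated c (t e).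
Proof.
rewrite integral_mkcond; apply: eq_integral => e _.
rewrite /patch /truncated; have [te|te] := boolP (0 < t e <= c)%R.
  by rewrite mem_set.
by rewrite memNset//; exact/negP.
Qed.

(** Integrating in u first: z exp(-u) is at most [c] only for u >= ln(z / c), so the
integral of z exp(-u) over this range and u >= 0 is min(z, c). *)
Lemma decayed_jump_small t (c : R) : (0 < c)%R -> moment (-1)%R pim < +oo ->
  \int[nu]_(e in [set e | 0 < decayed_jump t e <= c]%R) (decayed_jump t e)%:E < +oo.
Proof.
move=> c0 m1; rewrite integral_truncated integral_decayed_jump//.
pose F (uz : MR * MR) :=
  (\1_(`[0%R, +oo[ : set R) uz.1)%:E * truncated c (expR (- uz.1) * uz.2)%R.
have F0 uz : 0 <= F uz by rewrite mule_ge0// lee_fin.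
have mF : measurable_fun setT F.
  apply: emeasurable_funM.
    apply: (measurableT_comp (mind _) measurable_fst).
    exact: measurable_itv.
  apply: measurableT_comp => //; apply: measurable_funM => //.
  by apply: measurableT_comp => //; exact: measurableT_comp.
apply: lte_mul_pinfty => //.
- by apply: integral_ge0 => x _; rewrite lee_fin powR_ge0.
- by rewrite ge0_fin_numE//; apply: integral_ge0 => x _; rewrite lee_fin powR_ge0.
have -> : \int[leb]_(u in `[0%R, +oo[) \int[lam]_z truncated c (expR (- u) * z)%R =
    \int[lam]_z \int[leb]_u F (u, z).
  apply: etrans (fubini_tonelli F mF F0); rewrite integral_mkcond.
  apply: eq_integral => u _.
  rewrite /patch /F/= indicE; case: ifP => _.
    by apply: eq_integral => z _; rewrite mul1e.
  by rewrite integral0_eq// => z _; rewrite mul0e.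
apply: (integral_truncated_lty c0).
- exact: (measurable_fun_fubini_tonelli_G (m1 := leb) F mF F0).
- by move=> z; exact: integral_ge0.
- move=> z z0; apply: integral0_eq => u _; rewrite /F /truncated/= pmulr_rgt0 ?expR_gt0//.
  by rewrite ltNge z0 mule0.
move=> z z0; pose a := Num.max 0%R (ln (z / c)).
suff Fa : \int[leb]_u F (u, z) <= (z * expR (- a))%:E.
  have a0 : (0 <= a)%R by rewrite le_max lexx.
  split; apply: le_trans Fa _; rewrite lee_fin.
    by rewrite ger_pMr// -expR0 ler_expR oppr_le0.
  rewrite expRN ler_pdivrMr ?expR_gt0// mulrC -ler_pdivrMr//.
  by rewrite -[leLHS]lnK ?posrE ?divr_gt0// ler_expR le_max lexx orbT.
have mE : measurable_fun setT (fun u : MR => (expR (- u))%:E).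
  by apply/measurable_EFinP; apply: measurableT_comp => //; exact: measurableT_comp.
have -> : (z * expR (- a))%:E = \int[leb]_u (z%:E * ((expR (- u))%:E * (\1_(`[a, +oo[) u)%:E)).
  rewrite ge0_integralZl//; last 2 first.
  - by apply: emeasurable_funM => //; apply: mind; exact: measurable_itv.
  - by rewrite lee_fin ltW.
  rewrite EFinM -integral_exp_tail; congr (_ * _); rewrite [LHS]integral_mkcond.
  apply: eq_integral => u _; rewrite /patch indicE.
  by case: ifP => _; rewrite ?mule1 ?mule0.
apply: ge0_le_integral => //.
- exact: (measurableT_comp mF (measurable_pair2 z)).
- apply: measurable_funeM; apply: emeasurable_funM => //; apply: mind.
  exact: measurable_itv.
move=> u _; rewrite /F /truncated /=.
have rhs0 : 0 <= z%:E * ((expR (- u))%:E * (\1_(`[a, +oo[) u)%:E) :> \bar R.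
  by rewrite !mule_ge0// lee_fin ?expR_ge0 ?ltW.
case: ifP => [/andP[y0 yc]|_]; last by rewrite mule0.
rewrite indicE; case: (boolP (u \in _)) => [/set_mem|_]; last by rewrite mul0e.
rewrite /= in_itv/= andbT => u0; rewrite mul1e indicE mem_set ?mule1; last first.
  rewrite /= in_itv/= andbT ge_max u0/= -ler_expR lnK ?posrE ?divr_gt0//.
  rewrite ler_pdivrMr// -[leLHS]mul1r -(expR0) -(subrr u) expRD -mulrA.
  by rewrite ler_wpM2l ?expR_ge0.
by rewrite -EFinM lee_fin mulrC.
Qed.

Lemma integral_window_jump (H : R -> \bar R) t :
  measurable_fun setT H -> (forall y, 0 <= H y) -> H 0%R = 0 ->
  \int[nu]_e H (window_jump t e) = pim setT * \int[lam]_z H z.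
Proof.
move=> mH H0 H00.
rewrite integral_intensity//; last first.
  by apply: measurableT_comp => //; exact: measurable_window_jump.
rewrite (eq_integral (cst (\int[lam]_z H z))); last first.
  move=> x _ /=.
  transitivity (\int[leb]_s ((\1_(`]t, (t + 1)%R]) s)%:E * \int[lam]_z H z)).
    apply: eq_integral => s _; rewrite /window_jump/= indicE mem_setE /= in_itv/=.
    case: (t < s <= t + 1)%R; first by rewrite mul1e.
    by rewrite mul0e integral0_eq.
  rewrite ge0_integralZr//; last 2 first.
  - by apply/measurable_EFinP; exact: measurable_indic.
  - exact: integral_ge0.
  rewrite integral_indic ?setIT//= lebesgue_measure_itv/= lte_fin ltrDl ltr01.
  by rewrite -EFinD addrAC subrr add0r mul1e.
by rewrite integral_cst// muleC.
Qed.

Lemma window_jump_law t (B : set R) : measurable B -> B `<=` `]0%R, +oo[ ->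
  nu (window_jump t @^-1` B) = pim setT * lam B.
Proof.
move=> mB B0.
have mT : measurable (window_jump t @^-1` B).
  by rewrite -[X in measurable X]setTI; exact: measurable_window_jump.
have NB0 : ~ B 0%R by move=> /B0; rewrite /= in_itv/= ltxx.
transitivity (\int[nu]_e (\1_(window_jump t @^-1` B) e)%:E).
  by rewrite (integral_indic nu measurableT)// setIT.
rewrite (integral_window_jump t (H := EFin \o \1_B))//; last 3 first.
- by apply/measurable_EFinP; exact: measurable_indic.
- by move=> y; rewrite lee_fin.
- by rewrite /= indicE memNset.
by rewrite integral_indic ?setIT.
Qed.

Lemma window_jump_small t (c : R) : (0 < c)%R ->
  \int[nu]_(e in [set e | 0 < window_jump t e <= c]%R) (window_jump t e)%:E < +oo.
Proof.
move=> c0; rewrite integral_truncated integral_window_jump//.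
apply: lte_mul_pinfty => //; first by rewrite fin_num_measure.
apply: (integral_truncated_lty c0) => //.
  by move=> z z0; rewrite /truncated ltNge z0.
move=> z z0; rewrite /truncated z0/= !lee_fin.
by case: ifP => [zc|_]; split => //; rewrite ltW.
Qed.

End supou_jumps.

(** * Upper limits of the supOU process *)

Section limsup_at_infinity.
Context (R : realType).
Local Open Scope ereal_scope.

Lemma limf_esup_pinfty_ge (F : R -> \bar R) (K : \bar R) :
  (forall M, exists2 t, (M < t)%R & K <= F t) -> K <= limf_esup F +oo%R.
Proof.
move=> FK; rewrite limf_esupE; apply: le_ereal_inf_tmp => _ [V [M [_ MV]] <-].
have [t Mt Kt] := FK M; apply: le_trans Kt _.
by apply: ereal_sup_ubound; exists t => //; exact: MV.
Qed.

Lemma limf_esup_pinfty_le (F : R -> \bar R) (K : \bar R) (M : R) :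
  (forall t, (M < t)%R -> F t <= K) -> limf_esup F +oo%R <= K.
Proof.
move=> FK; rewrite limf_esupE.
apply: (@le_trans _ _ (ereal_sup [set F t | t in [set t | (M < t)%R]])).
  apply: ereal_inf_lbound; exists [set t | (M < t)%R] => //.
  by exists M; rewrite num_real.
by apply: ge_ereal_sup => _ [t Mt <-]; exact: FK.
Qed.

End limsup_at_infinity.

Section nonincreasing.
Context (R : realType) (W : R -> \bar R).
Hypothesis W_nincr : {homo W : s t / (s <= t)%R >-> (t <= s)%E}.
Hypothesis W_ge0 : forall t, (0 <= W t)%E.
Local Open Scope ereal_scope.

Lemma nonincreasing_emeasurable : measurable_fun setT W.
Proof.
move=> _; apply: (measurability _ (ErealGenOInfty.measurableE R)) => //.
move=> /= _ [_ [r ->] <-]; rewrite setTI preimage_itvoy.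
apply: is_interval_measurable => s t /= rs rt u /andP[su ut].
by rewrite /= (lt_le_trans rt)// W_nincr.
Qed.

(** Compare [W] on [n + 1, n + 2) with its value at the right endpoint. *)
Lemma nonincreasing_series_le_integral :
  \sum_(n <oo) W n.+2%:R <= \int[lebesgue_measure]_(t in `[1%R, +oo[) W t.
Proof.
pose I n : set R := `[n.+1%:R, n.+2%:R[%classic.
have mI n : measurable (I n) by exact: measurable_itv.
have leI n : lebesgue_measure (I n) = 1.
  rewrite /I lebesgue_measure_itv/= lte_fin ltr_nat ltnSn -EFinD.
  by rewrite -natrB// subSnn.
have tI : trivIset setT I.
  move=> i j _ _ [t [/=]]; rewrite /I/= !in_itv/= => /andP[it ti] /andP[jt tj].
  have : (i.+1%:R < j.+2%:R :> R)%R by exact: le_lt_trans tj.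
  have : (j.+1%:R < i.+2%:R :> R)%R by exact: le_lt_trans ti.
  by rewrite !ltr_nat !ltnS => ji ij; apply/eqP; rewrite eqn_leq ij ji.
have mW := nonincreasing_emeasurable.
apply: (@le_trans _ _ (\int[lebesgue_measure]_(t in \bigcup_n I n) W t)).
  rewrite ge0_integral_bigcup//; last exact: measurable_funTS.
  apply: lee_nneseries => // n _.
  apply: (@le_trans _ _ (\int[lebesgue_measure]_(t in I n) (cst (W n.+2%:R)) t)).
    have -> := integral_cst lebesgue_measure (mI n) (W n.+2%:R).
    by rewrite -[leLHS]mule1 -(leI n).
  apply: ge0_le_integral; [exact: mI|by move=> *; exact: W_ge0|exact: measurable_cst|
    exact: measurable_funTS|].
  by move=> t; rewrite /I/= in_itv/= => /andP[_ tn]; apply: W_nincr; exact: ltW.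
apply: ge0_subset_integral => //; first exact: bigcupT_measurable.
  exact: measurable_funTS.
move=> t [n _]; rewrite /I/= !in_itv/= andbT => /andP[nt _].
by apply: le_trans nt; rewrite ler1n.
Qed.

End nonincreasing.

Section supou_path.
Context (R : realType).
Local Notation MR := (measurableTypeR R).
Local Notation leb := (@lebesgue_measure R).
Context d (Omega : measurableType d) (P : probability Omega R).
Variables (pim : {finite_measure set MR -> \bar R})
  (lam : {sigma_finite_measure set MR -> \bar R})
  (pim_leb : {sigma_finite_measure set (MR * MR)%type -> \bar R}).
Hypothesis pim_pos : on_positive_half_line pim.
Hypothesis pim_lebE :
  pim_leb = (pim \x leb)%E :> (set (MR * MR)%type -> \bar R).
Let nu : {measure set (MR * MR * MR)%type -> \bar R} := (pim_leb \x lam)%E.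
Variables (mu : Omega -> {measure set (MR * MR * MR)%type -> \bar R})
  (A : nat -> set Omega) (xi tau zeta : nat -> {RV P >-> MR}).
Hypothesis prm : poisson_random_measure P nu mu.
Hypothesis points : supou_points mu A xi tau zeta.
Hypothesis lam_tail : forall r, 0 < r -> (lam `]r, +oo[%classic < +oo)%E.
Variable f : R -> R.
Hypothesis f_ndecr : {in `[1, +oo[ &, {homo f : s t / s <= t}}.
Hypothesis f1_gt0 : 0 < f 1.
Local Open Scope ereal_scope.

(* [f] made constant to the left of [1], so that it is monotone everywhere *)
Let ft (t : R) : R := f (Num.max t 1%R).

Let ft_ndecr : {homo ft : s t / (s <= t)%R}.
Proof.
move=> s t st; apply: f_ndecr; try by rewrite in_itv/= andbT le_max lexx orbT.
by rewrite ge_max !le_max st lexx orbT.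
Qed.

Let ftE t : (1 <= t)%R -> ft t = f t.
Proof. by move=> t1; rewrite /ft max_l. Qed.

Let ft_gt0 t : (0 < ft t)%R.
Proof.
apply: lt_le_trans f1_gt0 _; apply: f_ndecr; rewrite ?in_itv/= ?lexx//.
  by rewrite andbT le_max lexx orbT.
by rewrite le_max lexx orbT.
Qed.

Let tail_nincr (Q : {measure set MR -> \bar R}) (K : R) : (0 < K)%R ->
  {homo (fun t => tail Q (K * ft t)) : s t / (s <= t)%R >-> t <= s}.
Proof.
move=> K0 s t st; apply: le_measure; try by apply/mem_set; exact: measurable_itv.
move=> z; rewrite /= !in_itv/= !andbT; apply: le_lt_trans.
by rewrite ler_wpM2l ?(ltW K0)// ft_ndecr.
Qed.

(** The regions B n of points with s >= n + 1 and z > K f(s) have infinite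
intensity, since the integral of the tail over [1, n + 1) is finite. So almost
surely each of them contains a point, and X exceeds K f at its time. *)
Lemma supou_limsup_ge (K : R) : pim `]0%R, +oo[%classic != 0 -> (0 < K)%R ->
  \int[leb]_(t in `[1%R, +oo[) tail lam (K * f t) = +oo ->
  {ae P, forall w, K%:E <=
     limf_esup (fun t : R => supou A xi tau zeta t w / (f t)%:E) +oo%R}.
Proof.
move=> pim_neq0 K0 Ioo; have [mmu poismu _] := prm.
have [mA pts_gt0 pts] := points.
pose W t := tail lam (K * ft t).
have W_nincr : {homo W : s t / (s <= t)%R >-> t <= s} by exact: tail_nincr.
have W0 t : 0 <= W t by exact: measure_ge0.
have mW := nonincreasing_emeasurable W_nincr.
have mft : measurable_fun setT ft by exact: nondecreasing_measurable.
pose B n := [set e : MR * MR * MR | n.+1%:R <= e.1.2 /\ K * ft e.1.2 < e.2]%R.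
have ms : measurable_fun setT (fun e : MR * MR * MR => e.1.2 : R).
  by apply: (measurableT_comp measurable_snd); exact: measurable_fst.
have mB n : measurable (B n).
  rewrite (_ : B n = (fun e : MR * MR * MR => e.1.2 : R) @^-1` `[n.+1%:R, +oo[ `&`
      (fun e : MR * MR * MR => e.2 - K * ft e.1.2)%R @^-1` `]0%R, +oo[); last first.
    by apply/seteqP; split=> e; rewrite /B /= !in_itv/= !andbT subr_gt0.
  apply: measurableI; rewrite -[X in measurable X]setTI.
    by apply: ms => //; exact: measurable_itv.
  have mg : measurable_fun setT (fun e : MR * MR * MR => e.2 - K * ft e.1.2)%R.
    apply: measurable_funB; first exact: measurable_snd.
    by apply: measurable_funM => //; exact: measurableT_comp.
  by apply: mg => //; exact: measurable_itv.
have IWoo n : \int[leb]_(s in `[n.+1%:R, +oo[) W s = +oo.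
  apply/eqP; apply: contrapT => /negP Ilt.
  have n1 : (1 <= n.+1%:R :> R)%R by rewrite ler1n.
  have : \int[leb]_(t in `[1%R, +oo[) W t < +oo.
    rewrite (_ : `[1%R, +oo[%classic = `[1%R, n.+1%:R[ `|` `[n.+1%:R, +oo[); last first.
      apply/seteqP; split=> t /=; rewrite !in_itv/= !andbT.
        by move=> t1; case: (ltP t n.+1%:R) => tn; [left; rewrite t1|right].
      by move=> [/andP[]//|]; exact: le_trans.
    have mI1 : measurable (`[1%R, n.+1%:R[%classic : set R) by exact: measurable_itv.
    have mI2 : measurable (`[n.+1%:R, +oo[%classic : set R) by exact: measurable_itv.
    rewrite (ge0_integral_setU leb mI1 mI2)//; last 2 first.
    - exact: measurable_funTS.
    - apply/disj_setPRL => t /=; rewrite !in_itv/= andbT => nt /andP[_].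
      by rewrite ltNge nt.
    apply: lte_add_pinfty; last by rewrite ltey.
    apply: (@le_lt_trans _ _ (\int[leb]_(s in `[1%R, n.+1%:R[) (cst (W 1%R)) s)).
      apply: ge0_le_integral => //; first exact: measurable_funTS.
      by move=> t; rewrite /= in_itv/= => /andP[t1 _]; exact: W_nincr.
    rewrite integral_cst//=.
    rewrite lebesgue_measure_itv/=; case: ifP => _; last by rewrite mule0.
    rewrite -EFinD lte_mul_pinfty ?ltry// ge0_fin_numE//.
    by apply: lam_tail; rewrite mulr_gt0.
  rewrite (_ : \int[leb]_(t in _) W t = +oo)// -Ioo.
  by apply: eq_integral => t /set_mem; rewrite /= in_itv/= andbT /W => /ftE ->.
have pim_gt0 : 0 < pim setT.
  rewrite (lt_le_trans (_ : 0 < pim `]0%R, +oo[%classic))//.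
    by rewrite lt0e pim_neq0 measure_ge0.
  by apply: le_measure => //; apply/mem_set => //; exact: measurable_itv.
have nuB n : nu (B n) = +oo.
  transitivity (\int[nu]_e (\1_(B n) e)%:E).
    by rewrite (integral_indic nu measurableT)// setIT.
  rewrite (@integral_intensity R pim lam pim_leb pim_lebE (fun e => (\1_(B n) e)%:E)); last 2 first.
  - by apply/measurable_EFinP; exact: measurable_indic.
  - by move=> e; rewrite lee_fin.
  rewrite (eq_integral (cst +oo)) ?integral_cst//=; first by rewrite gt0_mulye.
  move=> x _; rewrite /= -(IWoo n) [RHS]integral_mkcond; apply: eq_integral => s _.
  rewrite /patch mem_setE in_itv/= andbT; case: ifPn => ns; last first.
    apply: integral0_eq => z _; rewrite indicE memNset// /B/= => -[ns' _].
    by rewrite ns' in ns.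
  rewrite /W /tail -[X in _ = lam X]setIT -(integral_indic lam measurableT); last first.
    exact: measurable_itv.
  apply: eq_integral => z _; congr EFin; rewrite !indicE; congr (_ : bool)%:R.
  rewrite mem_setE in_itv/= andbT; apply/idP/idP => [/set_mem[]//|Kz].
  exact/mem_set.
have muB n : P.-negligible (~` [set w | mu w (B n) = +oo]).
  have mBoo : measurable [set w | mu w (B n) = +oo].
    by apply: (emeasurable_preimage1 (N := fun w => mu w (B n))); exact: mmu.
  apply/negligibleP; first exact: measurableC.
  have := poismu _ (mB n); rewrite nuB /= => PB.
  by rewrite probability_setC// PB subee.
apply: negligibleS (negligible_bigcup muB) => w /= NK.
apply: contrapT => NB; apply: NK; apply: limf_esup_pinfty_ge => M.
have [n Mn] : exists n, (M < n.+1%:R)%R.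
  exists (Num.trunc `|M|); apply: le_lt_trans (ler_norm M) _.
  by have /andP[] := truncn_itv (normr_ge0 M).
have muBw : mu w (B n) = +oo by apply: contrapT => h; apply: NB; exists n.
have [k Ak Bk] : exists2 k, A k w & B n (xi k w, tau k w, zeta k w).
  apply: contrapT => Nk; move: muBw; rewrite pts// esum1// => k /= Ak.
  by rewrite diracE memNset// => Bk; apply: Nk; exists k.
move: Bk; rewrite /B/= => -[nt Kz].
have t1 : (1 <= tau k w)%R by apply: le_trans nt; rewrite ler1n.
exists (tau k w); first exact: lt_le_trans nt.
have ft0 : (0 < f (tau k w))%R by rewrite -ftE// ft_gt0.
rewrite inver gt_eqF// lee_pdivlMr// -EFinM.
apply: (@le_trans _ _ (zeta k w)%:E); first by rewrite lee_fin -ftE// ltW.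
apply: esum_ge; exists [set k].
  by split; [exact: finite_set1|move=> _ ->].
by rewrite fsbig_set1 subrr mulr0 expR0 mul1r.
Qed.

(** Points up to time n decay further on [n, t], points after n are bounded by
their full size. *)
Lemma supou_le_decayed_window (n t : R) w : (n <= t < n + 1)%R ->
  supou A xi tau zeta t w <=
  \esum_(k in [set k | A k w]) (decayed_jump n (xi k w, tau k w, zeta k w))%:E +
  \esum_(k in [set k | A k w]) (window_jump n (xi k w, tau k w, zeta k w))%:E.
Proof.
move=> /andP[nt tn]; have [_ pts_gt0 _] := points.
have dj0 k : A k w -> 0 <= (decayed_jump n (xi k w, tau k w, zeta k w))%:E.
  move=> /pts_gt0[_ /ltW z0]; rewrite lee_fin /decayed_jump; case: ifP => // _.
  by rewrite mulr_ge0 ?expR_ge0.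
have wj0 k : A k w -> 0 <= (window_jump n (xi k w, tau k w, zeta k w))%:E.
  by move=> /pts_gt0[_ /ltW z0]; rewrite lee_fin /window_jump; case: ifP.
rewrite -esumD// /supou.
rewrite [leLHS]esum_mkcond [leRHS]esum_mkcond; apply: le_esum => k _.
have [/set_mem Ak|nAk] := boolP (k \in [set k | A k w]); last first.
  by rewrite memNset// => -[Ak _]; move/negP: nAk; apply; exact/mem_set.
have [x0 z0] := pts_gt0 _ _ Ak.
have decay_le1 s : (tau k w <= s)%R -> (expR (- xi k w * (s - tau k w)) <= 1)%R.
  by move=> ts; rewrite -expR0 ler_expR mulNr oppr_le0 mulr_ge0 ?subr_ge0// ltW.
have [/set_mem[_ /= tk]|_] := boolP (k \in [set k | A k w /\ (tau k w <= t)%R]); last first.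
  by rewrite adde_ge0 ?dj0 ?wj0.
rewrite -EFinD lee_fin /decayed_jump /window_jump/=.
have [kn|kn] := leP (tau k w) n.
  rewrite addr0 ler_pM2r// ler_expR !mulNr lerN2 ler_pM2l// lerB//.
rewrite add0r (le_trans tk (ltW tn))/= ger_pMl// decay_le1//.
Qed.

Hypothesis lam_small : \int[lam]_(z in `]0%R, 1%R]) z%:E < +oo.
Hypothesis f_incr : {in `[1%R, +oo[ &, {homo f : s t / (s < t)%R}}.
Hypothesis f_derivable : derivable_cy f 1.
Hypothesis f_cvgy : (f t @[t --> +oo] --> +oo)%R.
Hypothesis g_submult :
  submultiplicative_on `[f 1%R, +oo[ ('pinv_(fun=> 1%R) `[1%R, +oo[ f).

(** [poisson_sums_eventually_le] applies to the sums of decayed jumps at integer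
times, with the tail of eta, and to the sums of jumps over unit windows, with a
multiple of the tail of lambda. *)
Lemma supou_limsup_le (L : R) : moment (-1)%R pim < +oo -> (0 < L)%R ->
  \int[leb]_(t in `[1%R, +oo[) (tail lam (L * f t) +
     tail (supou_marginal_levy_measure pim lam) (L * f t)) < +oo ->
  {ae P, forall w,
     limf_esup (fun t : R => supou A xi tau zeta t w / (f t)%:E) +oo%R <= (2 * L)%:E}.
Proof.
move=> m1 L0 Ioo; have [_ pts_gt0 pts] := points.
pose p k w : MR * MR * MR := (xi k w, tau k w, zeta k w).
have pE w B : measurable B -> mu w B = \esum_(k in [set k | A k w]) \d_(p k w) B.
  exact: pts.
have Lft0 t : (0 < L * ft t)%R by rewrite mulr_gt0.
have ray0 (x : R) : (0 < x)%R -> `]x, +oo[%classic `<=` `]0%R, +oo[.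
  by move=> x0 z /=; rewrite !in_itv/= !andbT; exact: lt_trans.
have mray (x : R) : measurable (`]x, +oo[%classic : set R) by exact: measurable_itv.
have djray x : (0 < x)%R -> nu [set e | x < decayed_jump 1 e]%R =
    tail (supou_marginal_levy_measure pim lam) x.
  move=> x0; rewrite /tail -(decayed_jump_law lam pim_pos pim_lebE 1%R (mray x) (ray0 _ x0)).
  by congr (_ _); apply/seteqP; split=> e /=; rewrite in_itv/= andbT.
have wjray x : (0 < x)%R -> nu [set e | x < window_jump 1 e]%R = pim setT * tail lam x.
  move=> x0; rewrite /tail -(window_jump_law lam pim_lebE 1%R (mray x) (ray0 _ x0)).
  by congr (_ _); apply/seteqP; split=> e /=; rewrite in_itv/= andbT.
have mdj x : measurable [set e | x < decayed_jump 1 e]%R.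
  rewrite (_ : [set e | _] = decayed_jump 1 @^-1` `]x, +oo[); last first.
    by apply/seteqP; split=> e /=; rewrite in_itv/= andbT.
  by rewrite -[X in measurable X]setTI; apply: measurable_decayed_jump.
pose V t := nu [set e | L * ft t < decayed_jump 1 e]%R.
pose W t := tail lam (L * ft t) + V t.
have V0 t : 0 <= V t by exact: measure_ge0.
have tail0 x : 0 <= tail lam x by exact: measure_ge0.
have W0 t : 0 <= W t by exact: adde_ge0.
have W_nincr : {homo W : s t / (s <= t)%R >-> t <= s}.
  move=> s t st; apply: leeD; first exact: tail_nincr.
  apply: le_measure; try by apply/mem_set; exact: mdj.
  by move=> e /=; apply: le_lt_trans; rewrite ler_pM2l// ft_ndecr.
have seriesW : \sum_(n <oo) W n.+2%:R < +oo.
  apply: le_lt_trans (nonincreasing_series_le_integral W_nincr W0) _.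
  apply: le_lt_trans Ioo; rewrite le_eqVlt; apply/orP; left; apply/eqP.
  apply: eq_integral => t /set_mem; rewrite /= in_itv/= andbT => t1.
  by rewrite /W /V (djray _ (Lft0 t)) (ftE t1).
have nat1 n : (1 <= n.+1%:R :> R)%R by rewrite ler1n.
have decayed := @poisson_sums_eventually_le _ _ _ P _ _ nu mu prm A p pE f L
  f_incr f_derivable f_cvgy f1_gt0 g_submult L0
  (fun k => decayed_jump k.+1%:R) (fun k => @measurable_decayed_jump R k.+1%:R).
have window := @poisson_sums_eventually_le _ _ _ P _ _ nu mu prm A p pE f L
  f_incr f_derivable f_cvgy f1_gt0 g_submult L0
  (fun k => window_jump k.+1%:R) (fun k => @measurable_window_jump R k.+1%:R).
have {}decayed : {ae P, forall w, exists K, forall k, (K <= k)%N ->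
    \esum_(j in [set j | A j w]) (decayed_jump k.+1%:R (p j w))%:E <=
    (L * f k.+1%:R)%:E}.
  apply: decayed.
  - move=> k j w /pts_gt0[_ /ltW z0]; rewrite /decayed_jump; case: ifP => // _.
    by rewrite mulr_ge0 ?expR_ge0.
  - by move=> k B mB B0; rewrite !(decayed_jump_law lam pim_pos pim_lebE _ mB B0).
  - by move=> c c0; exact: (decayed_jump_small pim_pos pim_lebE lam_small lam_tail).
  apply: le_lt_trans seriesW; apply: lee_nneseries => // n _.
  by rewrite /W /V ftE//; exact: leeDr.
have {}window : {ae P, forall w, exists K, forall k, (K <= k)%N ->
    \esum_(j in [set j | A j w]) (window_jump k.+1%:R (p j w))%:E <=
    (L * f k.+1%:R)%:E}.
  apply: window.
  - by move=> k j w /pts_gt0[_ /ltW z0]; rewrite /window_jump; case: ifP.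
  - by move=> k B mB B0; rewrite !(window_jump_law lam pim_lebE _ mB B0).
  - by move=> c c0; exact: (window_jump_small pim_lebE lam_small lam_tail).
  apply: (@le_lt_trans _ _ (\sum_(n <oo) ((fine (pim setT))%:E * W n.+2%:R))).
    apply: lee_nneseries => // n _.
    rewrite wjray ?mulr_gt0 -?ftE ?ft_gt0// fineK ?fin_num_measure//.
    by rewrite lee_wpmul2l// /W leeDl.
  by rewrite nneseriesZl// lte_mul_pinfty// lee_fin fine_ge0.
apply: filterS2 decayed window => w [K1 dK1] [K2 wK2].
apply: (@limf_esup_pinfty_le _ _ _ (maxn K1 K2).+1%:R) => t Kt.
have t0 : (0 <= t)%R by rewrite (le_trans _ (ltW Kt)).
set n := (Num.trunc t).-1.
have truncE : Num.trunc t = n.+1.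
  by rewrite prednK// truncn_gt0 (le_trans _ (ltW Kt)).
have /andP[nt tn] := truncn_itv t0; rewrite truncE in nt tn.
have Kn : (maxn K1 K2 <= n)%N.
  have : ((maxn K1 K2).+1%:R < n.+2%:R :> R)%R by exact: lt_trans tn.
  by rewrite ltr_nat ltnS.
have ft0 : (0 < f t)%R by rewrite -ftE ?ft_gt0// (le_trans (nat1 n)).
rewrite inver gt_eqF// lee_pdivrMr// -EFinM.
have nt1 : (n.+1%:R <= t < n.+1%:R + 1)%R by rewrite nt natr1.
apply: le_trans (supou_le_decayed_window w nt1) _.
apply: le_trans (leeD (dK1 n _) (wK2 n _)) _.
- exact: leq_trans (leq_maxl _ _) Kn.
- exact: leq_trans (leq_maxr _ _) Kn.
have Lf : (L * f n.+1%:R <= L * f t)%R.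
  by rewrite ler_pM2l// -!ftE ?ft_ndecr// (le_trans (nat1 n)).
by rewrite -EFinD lee_fin; lra.
Qed.

End supou_path.

(** * Finiteness of the characteristics *)

Section characteristics.
Context (R : realType).
Local Notation MR := (measurableTypeR R).
Local Notation leb := (@lebesgue_measure R).
Local Open Scope ereal_scope.

(** Markov's inequality for min(1, z^2), which is at least min(1, r^2) on
(r, oo). *)
Lemma levy_measure_tail_lty (lam : {measure set MR -> \bar R}) (r : R) :
  levy_measure lam -> (0 < r)%R -> lam `]r, +oo[%classic < +oo.
Proof.
move=> [_ lam_levy] r0; pose m : R := Num.min 1%R (r ^+ 2)%R.
have m0 : (0 < m)%R by rewrite lt_min ltr01 exprn_gt0.
have mray : measurable (`]r, +oo[%classic : set MR) by exact: measurable_itv.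
suff : m%:E * lam `]r, +oo[%classic < +oo.
  by case: (lam _) (measure_ge0 lam `]r, +oo[) => [x _ _| |//]; rewrite ?ltry// gt0_muley.
apply: le_lt_trans lam_levy.
have mmin : measurable_fun setT (fun z : MR => (Num.min 1%R (z ^+ 2)%R)%:E).
  apply/measurable_EFinP; exact: measurable_minr.
have min0 (z : R) : 0 <= (Num.min 1%R (z ^+ 2)%R)%:E.
  by rewrite lee_fin le_min ler01 sqr_ge0.
apply: (@le_trans _ _ (\int[lam]_(z in `]r, +oo[) (Num.min 1%R (z ^+ 2)%R)%:E)).
  rewrite -(integral_cst lam mray); apply: ge0_le_integral => //.
  - by move=> z _; rewrite lee_fin ltW.
  - exact: measurable_funTS.
  move=> z; rewrite /= in_itv/= andbT => rz; rewrite lee_fin /m le_min !ge_min lexx/=.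
  have z0 := lt_trans r0 rz.
  by rewrite ler_sqr ?nnegrE ?(ltW r0) ?(ltW z0)// (ltW rz) orbT.
apply: ge0_subset_integral => //.
- exact: measurable_funTS.
- by move=> z; rewrite /= !in_itv/= !andbT; exact: lt_trans.
Qed.

Lemma levy_measure_sigma_finite (lam : {measure set MR -> \bar R}) :
  levy_measure lam -> sigma_finite setT lam.
Proof.
move=> lam_levy; have [lam_pos _] := lam_levy.
pose ray (n : nat) : set MR := `](n.+1%:R^-1)%R, +oo[%classic.
pose F n := ~` (`]0%R, +oo[%classic : set MR) `|` ray n.
have mray n : measurable (ray n) by exact: measurable_itv.
have mneg : measurable (~` (`]0%R, +oo[%classic : set MR)).
  by apply: measurableC; exact: measurable_itv.
exists F => [|n].
  apply/esym/seteqP; split=> // z _; have [z0|z0] := ltP 0%R z; last first.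
    by exists 0%N => //; left => /=; rewrite in_itv/= andbT ltNge z0.
  exists (Num.trunc z^-1) => //; right; rewrite /ray/= in_itv/= andbT.
  rewrite invf_plt ?posrE//.
  by have /andP[] := truncn_itv (ltW (eqbRL (invr_gt0 z) z0)).
split; first exact: measurableU.
apply: le_lt_trans (measureU2 _ _ _) _ => //.
apply: lte_add_pinfty; first by rewrite [X in X < _]lam_pos.
by apply: levy_measure_tail_lty => //; rewrite invr_gt0.
Qed.

Lemma finite_prod_lebesgue_sigma_finite (pim : {finite_measure set MR -> \bar R}) :
  sigma_finite setT (pim \x leb).
Proof.
pose I (n : nat) : set MR := `[(- n%:R)%R, n%:R%R]%classic.
have mI n : measurable (I n) by exact: measurable_itv.
exists (fun n => setT `*` I n) => [|n].
  apply/esym/seteqP; split=> // -[x s] _.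
  exists (Num.trunc `|s|).+1 => //; split=> //=.
  rewrite /I/= in_itv/= -ler_norml; apply: ltW.
  by have /andP[] := truncn_itv (normr_ge0 s).
split; first exact: measurableX.
rewrite product_measure1E// lte_mul_pinfty// ?fin_num_measure//.
rewrite /I /= lebesgue_measure_itv/=; case: ifP => _ //.
by rewrite -EFinD ltry.
Qed.

End characteristics.
Unset Implicit Arguments.

Theorem theorem1 (R : realType) (d : measure_display) (Omega : measurableType d)
    (P : probability Omega R)
    (pim lam : {measure set (measurableTypeR R) -> \bar R})
    (mu : Omega -> {measure set (measurableTypeR R * measurableTypeR R *
                                 measurableTypeR R) -> \bar R})
    (A : nat -> set Omega)
    (xi tau zeta : nat -> {RV P >-> measurableTypeR R})
    (f : R -> R)
    (pim_pos : on_positive_half_line pim)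
    (pim_neq0 : pim `]0, +oo[%classic != 0%E)
    (pim_m1 : (moment (-1)%R pim < +oo)%E)
    (lam_levy : levy_measure lam)
    (lam_log : (\int[lam]_(z in `]1%R, +oo[) (ln z)%:E < +oo)%E)
    (mu_poisson : poisson_random_measure P (supou_intensity pim lam) mu)
    (mu_points : supou_points mu A xi tau zeta)
    (lam_small : (\int[lam]_(z in `]0%R, 1%R]) z%:E < +oo)%E)
    (pim_m0 : (moment 0%R pim < +oo)%E)
    (f_ndecr : {in `[1, +oo[ &, {homo f : s t / s <= t}})
    (f1_gt0 : 0 < f 1)
    (f_cvgy : f t @[t --> +oo] --> +oo) :
  let X := supou A xi tau zeta in
  let eta := supou_marginal_levy_measure pim lam in
  (forall K : R, 0 < K ->
     (\int[lebesgue_measure]_(t in `[1%R, +oo[) tail lam (K * f t) = +oo)%E ->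
     {ae P, forall w,
        (K%:E <= limf_esup (fun t : R => X t w / (f t)%:E) +oo%R)%E}) /\
  ({in `[1, +oo[ &, {homo f : s t / s < t}} ->
   derivable_cy f 1 ->
   submultiplicative_on `[f 1, +oo[ ('pinv_(fun=> 1) `[1, +oo[ f) ->
   forall L : R, 0 < L ->
     (\int[lebesgue_measure]_(t in `[1%R, +oo[)
        (tail lam (L * f t) + tail eta (L * f t)) < +oo)%E ->
     {ae P, forall w,
        (limf_esup (fun t : R => X t w / (f t)%:E) +oo%R <= (2 * L)%:E)%E}).
Proof.
have mpos : measurable (`]0%R, +oo[%classic : set (measurableTypeR R)).
  exact: measurable_itv.
have pim_fin : (pim setT < +oo)%E.
  rewrite -(setvU `]0%R, +oo[%classic) (le_lt_trans (measureU2 _ _ _))//.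
    exact: measurableC.
  rewrite [X in (X + _)%E]pim_pos add0e; apply: le_lt_trans pim_m0.
  rewrite /moment (eq_integral (cst 1%E)) ?integral_cst ?mul1e//.
  by move=> x _; rewrite powRr0.
have lam_tail (r : R) : 0 < r -> (lam `]r, +oo[%classic < +oo)%E.
  exact: levy_measure_tail_lty.
have [pim' pimE] := finite_measure_of pim_fin.
have [lam' lamE] := sigma_finite_measure_of (levy_measure_sigma_finite lam_levy).
have [pim_leb pim_lebE] :=
  sigma_finite_measure_of (finite_prod_lebesgue_sigma_finite pim').
have intensityE : supou_intensity pim lam = (pim_leb \x lam')%E.
  by rewrite /supou_intensity pimE lamE pim_lebE.
rewrite intensityE in mu_poisson.
rewrite pimE in pim_pos pim_neq0 pim_m1 *.
rewrite lamE in lam_small lam_tail *.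
move=> X eta; split=> [K K0|f_incr f_derivable g_submult L L0].
  exact: (supou_limsup_ge (esym pim_lebE) mu_poisson mu_points).
exact: (supou_limsup_le pim_pos (esym pim_lebE) mu_poisson mu_points).
Qed.
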